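(* Let $S$ be a closed densely defined symmetric operator with equal defect numbers in a Hilbert space $\mathfrak{H}$ which commutes with a non-trivial fundamental symmetry $J$, and let $\{C_\alpha\}_{\alpha\in D}$ be the set of all $C$-symmetries of $S$. Let $(\mathcal{H},\Gamma_0,\Gamma_1)$ be a boundary triplet for $S^*$ such that the formulas $$\mathcal{C}_\alpha\Gamma_0 f=\Gamma_0C_\alpha f,\qquad \mathcal{C}_\alpha\Gamma_1 f=\Gamma_1C_\alpha f,\qquad \forall\alpha\in D,\ \forall f\in\mathcal{D}(S^* )$$ correctly define an operator family $\{\mathcal{C}_\alpha\}_{\alpha\in D}$ in $\mathcal{H}$, let $\mathcal{J}$ be the operator $\mathcal{C}_\alpha$ corresponding to $C_\alpha=J$, let $M(\cdot)$ and $\gamma(\cdot)$ be the associated Weyl function and $\gamma$-field, and let $A_0=S^*\upharpoonright\ker\Gamma_0$. Then a closed linear operator $A$ in $\mathfrak{H}$ belongs to $\Sigma_J^{\mathsf{st}}$ if and only if $\rho(A)\cap\rho(A_0)\neq\emptyset$ and $$(A-\mu I)^{-1}=(A_0-\mu I)^{-1}-\gamma(\mu)\,(M(\mu)-\mathcal{R})^{-1}\,\gamma(\overline{\mu})^*,\qquad \mu\in\rho(A)\cap\rho(A_0),$$ where $\mathcal{R}$ is a $\mathcal{J}$-self-adjoint relation in $\mathcal{H}$ which has the $\mathcal{C}$-symmetry in $(\mathcal{H},[\cdot,\cdot]_{\mathcal{J}})$ for some $\mathcal{C}$ such that $[\mathcal{C},M(\cdot)]=0$. Furthermore, for such $A$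 and the corresponding $\mathcal{R}$: $A$ is disjoint with $A_0$ (i.e. $\mathcal{D}(A)\cap\mathcal{D}(A_0)=\mathcal{D}(S)$) if and only if $\mathcal{R}$ is (the graph of) an operator with the indicated $\mathcal{C}$-symmetry; and $A$ is transversal with $A_0$ (i.e. $\mathcal{D}(A)\cap\mathcal{D}(A_0)=\mathcal{D}(S)$ and $\mathcal{D}(A)+\mathcal{D}(A_0)=\mathcal{D}(S^* )$) if and only if $\mathcal{R}$ is a bounded (everywhere defined) operator with the indicated $\mathcal{C}$-symmetry.
   Context: $\mathfrak{H}$ is a Hilbert space with inner product $(\cdot,\cdot)$. A fundamental symmetry is a bounded operator $J$ with $J=J^*$, $J^2=I$; it is non-trivial if $J\neq\pm I$. For a bounded operator $C$ and an operator $A$, ''$A$ commutes with $C$'', written $[A,C]=0$, means $AC=CA$ (including equality of domains). For bounded $T$, $T>0$ means $T$ is self-adjoint and $(Tx,x)>0$ for all $x\neq0$. $\{C_\alpha\}_{\alpha\in D}$ denotes the set (indexed by a set $D$) of all bounded operators $C$ in $\mathfrak{H}$ with $C^2=I$, $JC>0$ and $SC=CS$. It contains $J$. Each such $C$ also commutes with $S^*$. An operator $A$ is $J$-self-adjoint if it is densely defined and $A^*J=JA$. $\Sigma_J$ is the set of $J$-self-adjoint extensions $A\supset S$. $\Sigma_J^{\mathsf{st}}$ (stable $C$-symmetry) is the set of $A\in\Sigma_J$ such that $[A,C_\alpha]=0$ for at least one $\alpha\in D$. A boundary triplet for $S^*$ is a triplet $(\mathcal{H},\Gamma_0,\Gamma_1)$,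 where $\mathcal{H}$ is a Hilbert space and $\Gamma_0,\Gamma_1:\mathcal{D}(S^* )\to\mathcal{H}$ are linear, such that $(S^*x,y)-(x,S^*y)=(\Gamma_1x,\Gamma_0y)_{\mathcal{H}}-(\Gamma_0x,\Gamma_1y)_{\mathcal{H}}$ for all $x,y\in\mathcal{D}(S^* )$ and $(\Gamma_0,\Gamma_1):\mathcal{D}(S^* )\to\mathcal{H}\oplus\mathcal{H}$ is surjective. Then $A_0=S^*\upharpoonright\ker\Gamma_0$ is self-adjoint. ''Correctly define'' means that for each $\alpha$ there is a single well-defined operator $\mathcal{C}_\alpha$ in $\mathcal{H}$ satisfying both formulas. For $\mu\in\rho(A_0)$: the $\gamma$-field is $\gamma(\mu)=(\Gamma_0\upharpoonright\ker(S^*-\mu I))^{-1}:\mathcal{H}\to\mathfrak{H}$, and the Weyl function is the bounded operator $M(\mu)=\Gamma_1\gamma(\mu)$ in $\mathcal{H}$, i.e. $M(\mu)\Gamma_0f_\mu=\Gamma_1f_\mu$ for $f_\mu\in\ker(S^*-\mu I)$. $[\mathcal{C},M(\cdot)]=0$ means $\mathcal{C}M(\lambda)=M(\lambda)\mathcal{C}$ for all $\lambda\in\mathbb{C}\setminus\mathbb{R}$. $\mathcal{J}$ is a fundamental symmetry in $\mathcal{H}$, and $[x,y]_{\mathcal{J}}=(\mathcal{J}x,y)_{\mathcal{H}}$. A (closed linear) relation $\mathcal{R}$ in $\mathcal{H}$ is a closed linear subspace of $\mathcal{H}\times\mathcal{H}$; it is $\mathcal{J}$-self-adjoint if $\mathcal{R}=\{\{g,g'\}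 : [f',g]_{\mathcal{J}}=[f,g']_{\mathcal{J}}\ \ \forall\{f,f'\}\in\mathcal{R}\}$. It has the $\mathcal{C}$-symmetry if $\mathcal{C}$ is a bounded operator in $\mathcal{H}$ with $\mathcal{C}^2=I$, $\mathcal{J}\mathcal{C}>0$ and $[\mathcal{R},\mathcal{C}]=0$, where the latter means $\mathcal{R}=\{\{\mathcal{C}f,\mathcal{C}f'\} : \{f,f'\}\in\mathcal{R}\}$. The inverse $(M(\mu)-\mathcal{R})^{-1}$ is taken in the sense of relations: $\{\{M(\mu)f-f',f\}:\{f,f'\}\in\mathcal{R}\}$. *)

(* Defs.v *)
From HB Require Import structures.
From mathcomp Require Import all_boot all_order all_algebra sesquilinear.
From mathcomp Require Import all_classical all_reals all_analysis.
From mathcomp Require Import complex.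

Set Implicit Arguments.
Unset Strict Implicit.
Unset Printing Implicit Defensive.

Import Order.TTheory GRing.Theory Num.Theory numFieldNormedType.Exports.

Local Open Scope classical_set_scope.
Local Open Scope complex_scope.
Local Open Scope ring_scope.
Local Open Scope relation_scope.

(* A complex Hilbert space.  The inner product is linear in its first argument
   and conjugate-linear in its second; the norm takes its values in R[i]. *)
HB.mixin Record isHilbert (R : realType) H of CompleteNormedModule R[i] H := {
  inner : {dot H for (@Num.conj R[i])} ;
  sqr_norm_inner : forall x : H, `|x| ^+ 2 = inner x x }.

#[short(type="hilbertType")]
HB.structure Definition Hilbert (R : realType) :=
  { H of CompleteNormedModule R[i] H & isHilbert R H }.

(* An operator U -> V that need not be everywhere defined is identified with
   its graph, a linear subspace of U * V; a linear relation is such a subspace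
   that need not be single-valued.  Products, inverses and differences are those
   of relations, so that equality of operators includes equality of domains.
   Bounded, everywhere defined operators are functions, and enter products
   through [graph].  In relation_scope, [B \; A] is "B after A". *)
Section Relations.
Variable R : realType.
Implicit Types U V : hilbertType R.

Definition closed_relation U V (A : set (U * V)) :=
  submod_closed (mem A) /\ closed A.

Definition single_valued U V (A : set (U * V)) :=
  forall x y z, A (x, y) -> A (x, z) -> y = z.

Definition closed_operator U V (A : set (U * V)) :=
  closed_relation A /\ single_valued A.

Definition bounded_operator U V (T : U -> V) := linear T /\ continuous T.

Definition graph U V (T : U -> V) : set (U * V) := [set p | p.2 = T p.1].

Definition reldom U V (A : set (U * V)) : set U :=
  [set x | exists y, A (x, y)].

Definition rel_sub U V (A B : set (U * V)) : set (U * V) :=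
  [set p | exists y z, [/\ A (p.1, y), B (p.1, z) & p.2 = y - z]].

Definition adjoint U V (A : set (U * V)) : set (V * U) :=
  [set q | forall p, A p -> inner p.2 q.1 = inner p.1 q.2].

Definition densely_defined U V (A : set (U * V)) := dense (reldom A).

Definition commutes U (A : set (U * U)) (C : U -> U) :=
  A \; graph C = graph C \; A.

Definition resolvent U (A : set (U * U)) (mu : R[i]) : set (U * U) :=
  (rel_sub A (graph ( *:%R mu)))^-1.

Definition resolvent_set U (A : set (U * U)) : set R[i] :=
  [set mu | exists2 B : U -> U, bounded_operator B & resolvent A mu = graph B].

Definition bounded_selfadjoint U (T : U -> U) :=
  bounded_operator T /\ adjoint (graph T) = graph T.

Definition positive_operator U (T : U -> U) :=
  bounded_selfadjoint T /\ forall x, x != 0 -> 0 < inner (T x) x.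

Definition fundamental_symmetry U (J : U -> U) :=
  bounded_selfadjoint J /\ J \o J = id.

End Relations.

Section Extensions.
Variables (R : realType) (H : hilbertType R).
Implicit Types (S A : set (H * H)) (J C : H -> H).

Definition symmetric_operator S := S `<=` adjoint S.

Definition defect_space S (lambda : R[i]) : set H :=
  [set f | adjoint S (f, lambda *: f)].

Definition orthonormal_basis (N B : set H) :=
  [/\ B `<=` N,
      forall e f, B e -> B f -> inner e f = (e == f)%:R
    & forall x, N x -> (forall e, B e -> inner x e = 0) -> x = 0].

(* Defect numbers may be infinite cardinals: they are compared through
   orthonormal bases of the two defect subspaces. *)
Definition equal_defect_numbers S :=
  exists B1 B2 : set H,
    [/\ orthonormal_basis (defect_space S 'i) B1,
        orthonormal_basis (defect_space S (- 'i)) B2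
      & (B1 #= B2)%card].

Definition C_symmetry_of S J C :=
  [/\ bounded_operator C, C \o C = id, positive_operator (J \o C)
    & commutes S C].

Definition J_selfadjoint J A :=
  densely_defined A /\ adjoint A \; graph J = graph J \; A.

Definition Sigma S J A :=
  [/\ submod_closed (mem A), single_valued A, S `<=` A & J_selfadjoint J A].

Definition Sigma_st S J (D : Type) (C_ : D -> H -> H) A :=
  Sigma S J A /\ exists a, commutes A (C_ a).

Definition disjoint_extensions S A A0 := reldom A `&` reldom A0 = reldom S.

Definition transversal_extensions S A A0 :=
  disjoint_extensions S A A0 /\
  [set x + y | x in reldom A & y in reldom A0] = reldom (adjoint S).

End Extensions.

Section BoundaryTriplets.
Variables (R : realType) (H HH : hilbertType R).
Variables (S : set (H * H)) (G0 G1 : H -> HH).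

Definition linear_on (E : set H) (G : H -> HH) :=
  forall (a : R[i]) x y, E x -> E y -> G (a *: x + y) = a *: G x + G y.

(* The boundary maps are defined on the domain of the adjoint of S; they are
   represented by functions on H whose values elsewhere are never used. *)
Definition boundary_triplet :=
  [/\ linear_on (reldom (adjoint S)) G0,
      linear_on (reldom (adjoint S)) G1,
      forall x x' y y', adjoint S (x, x') -> adjoint S (y, y') ->
        inner x' y - inner x y' =
        inner (G1 x) (G0 y) - inner (G0 x) (G1 y)
    & [set (G0 f, G1 f) | f in reldom (adjoint S)] = setT].

Definition A_0 : set (H * H) := [set p | adjoint S p /\ G0 p.1 = 0].

Definition gamma_field (mu : R[i]) : set (HH * H) :=
  [set (G0 f, f) | f in defect_space S mu].

Definition weyl_function (mu : R[i]) : set (HH * HH) :=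
  [set (G0 f, G1 f) | f in defect_space S mu].

Definition boundary_image (C : H -> H) (cC : HH -> HH) :=
  linear cC /\ forall f, reldom (adjoint S) f ->
    cC (G0 f) = G0 (C f) /\ cC (G1 f) = G1 (C f).

Definition correctly_define (D : Type) (C_ : D -> H -> H)
    (cC_ : D -> HH -> HH) :=
  forall a, unique (boundary_image (C_ a)) (cC_ a).

Definition krein_formula (A : set (H * H)) (K : set (HH * HH)) :=
  forall mu, (resolvent_set A `&` resolvent_set A_0) mu ->
    resolvent A mu =
    rel_sub (resolvent A_0 mu)
      (gamma_field mu \;
        ((rel_sub (weyl_function mu) K)^-1 \; adjoint (gamma_field mu^*%R))).

Definition J_selfadjoint_relation (cJ : HH -> HH) (K : set (HH * HH)) :=
  closed_relation K /\
  K = [set g | forall f, K f -> inner (cJ f.2) g.1 = inner (cJ f.1) g.2].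

Definition relation_C_symmetry (cJ : HH -> HH) (K : set (HH * HH))
    (cC : HH -> HH) :=
  [/\ bounded_operator cC, cC \o cC = id, positive_operator (cJ \o cC)
    & K = [set (cC f.1, cC f.2) | f in K]].

Definition commutes_weyl (cC : HH -> HH) :=
  forall lambda : R[i], lambda \isn't Num.real ->
    commutes (weyl_function lambda) cC.

Definition admissible_parameter (cJ : HH -> HH) (K : set (HH * HH))
    (cC : HH -> HH) :=
  [/\ J_selfadjoint_relation cJ K, relation_C_symmetry cJ K cC
    & commutes_weyl cC].

End BoundaryTriplets.

(* Main.v *)
Require Import Defs.
From HB Require Import structures.
From mathcomp Require Import all_boot all_order all_algebra sesquilinear.
From mathcomp Require Import all_classical all_reals all_analysis.
From mathcomp Require Import complex.
From mathcomp Require Import ring lra.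

(** An extension of [S] inside its adjoint consists of the [f] with
    [(Gamma_0 f, Gamma_1 f)] in [K], for a unique relation [K], and Krein's formula
    for [K] says precisely that [A] is this extension.  By Green's identity,
    [J]-self-adjointness of [A] and commutation with [C] become the same properties of
    [K] with respect to [cJ] and [cC].  For [A] in [Sigma_st] the resolvent set contains
    the nonreal numbers because [A] is self-adjoint for the equivalent inner product
    [(JC x, y)].

    It remains to relate symmetries of [S] and of the Weyl function.  Boundedness and
    positivity of an operator [d] in one space are obtained from those of its
    counterpart in the other space by the following remark: if [d] is symmetric and
    [|<d^n u, u>| <= K_u c^n] for all [n], then [|d u| <= c |u|].  Conversely, let [cC]
    commute with [M].  The operator [C] is prescribed by
    [C (gamma(l) u) = gamma(l) (cC u)] on the closed span of the defect spaces and by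
    [C = J] on its orthogonal complement.  The form [<gamma(l) u, gamma(m) v>] is
    determined by [M], so [cC' cC], where [cC'] is the adjoint of [cC], is symmetric for
    it, and the same remark bounds [C]. *)

Set Implicit Arguments.
Unset Strict Implicit.
Unset Printing Implicit Defensive.

Import Order.TTheory GRing.Theory Num.Theory numFieldNormedType.Exports.

Local Open Scope classical_set_scope.
Local Open Scope ring_scope.
Local Open Scope complex_scope.

(** * Norms and inner products *)

Section Norm.
Variable R : realType.

(** The obstacle in the converse direction is boundedness: different defect spaces are not
    orthogonal, so nothing visibly controls [gamma(l) u -> gamma(l) (cC u)] on finite sums. In
    general neither [cC] nor its adjoint is symmetric for the form on these sums, so the growth
    argument is applied to their product, and to [b - cJ cC] when positivity is at stake. It works
    because [K_u] disappears under [2^n]-th roots: a crude estimate, through Green's identity in one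
    direction and through [gamma(l)^*] in the other, yields the exact bound known in the other
    space. On the complement of the defect spaces [M] prescribes nothing; [C = J] makes [JC] the
    identity there, and both [J] and the resolvent of [A_0] leave that complement invariant. *)

Definition nrm (V : normedZmodType R[i]) (x : V) : R := complex.Re `|x|.

Section Zmod.
Variable V : normedZmodType R[i].
Implicit Types x y : V.

Lemma nrmE x : `|x| = (nrm x)%:C.
Proof. by rewrite RRe_real // normr_real. Qed.

Lemma nrm_ge0 x : 0 <= nrm x.
Proof. by rewrite -ler0c -nrmE. Qed.

Lemma nrm_eq0 x : nrm x = 0 -> x = 0.
Proof. by move=> x0; apply/normr0_eq0; rewrite nrmE x0. Qed.

Lemma nrm0 : nrm (0 : V) = 0.
Proof. by rewrite /nrm normr0. Qed.

Lemma nrmN x : nrm (- x) = nrm x.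
Proof. by rewrite /nrm normrN. Qed.

Lemma nrm_dist x y : nrm (x - y) = nrm (y - x).
Proof. by rewrite -nrmN opprB. Qed.

Lemma nrmD x y : nrm (x + y) <= nrm x + nrm y.
Proof. by rewrite -lecR rmorphD /= -!nrmE ler_normD. Qed.

Lemma nrmB x y : nrm (x - y) <= nrm x + nrm y.
Proof. by rewrite -(nrmN y) nrmD. Qed.

Lemma nrm_triangle y x z : nrm (x - z) <= nrm (x - y) + nrm (y - z).
Proof. by rewrite -(subrKA y) nrmD. Qed.

(** Closing step of limit arguments: the fixed [K] collects the constants of an estimate that is
    linear in the error [e]. *)
Lemma nrm_small x (K : R) : (forall e, 0 < e -> nrm x <= e * K) -> x = 0.
Proof.
move=> h; apply/nrm_eq0/eqP; rewrite eq_le nrm_ge0 andbT.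
apply/ler_addgt0Pr => e e0; rewrite add0r.
have p : 0 < `|K| + 1 by rewrite ltr_wpDl.
apply: le_trans (h _ (divr_gt0 e0 p)) _.
rewrite -mulrA ler_piMr ?(ltW e0)// ler_pdivrMl// mulr1.
by rewrite (le_trans (ler_norm _))// lerDl.
Qed.

End Zmod.

Lemma nrmM (a b : R[i]) : nrm (a * b) = nrm a * nrm b.
Proof. by apply: complexI; rewrite rmorphM /= -!nrmE normrM. Qed.

Lemma nrmZ (V : normedModType R[i]) (a : R[i]) (x : V) :
  nrm (a *: x) = nrm a * nrm x.
Proof. by apply: complexI; rewrite rmorphM /= -!nrmE normrZ. Qed.

Lemma nrmC (r : R) : nrm (r%:C) = `|r|.
Proof. by rewrite /nrm normc_def/= expr0n addr0 sqrtr_sqr. Qed.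

Lemma Im_le_nrm (a : R[i]) : `|complex.Im a| <= nrm a.
Proof.
rewrite /nrm normc_def/= -sqrtr_sqr ler_wsqrtr//.
by rewrite lerDr sqr_ge0.
Qed.

Lemma Re_le_nrm (a : R[i]) : complex.Re a <= nrm a.
Proof.
rewrite /nrm normc_def/= (le_trans (ler_norm _))// -sqrtr_sqr ler_wsqrtr//.
by rewrite lerDl sqr_ge0.
Qed.

Lemma conjCE (a : R[i]) : a^*%R = a^*%C.
Proof.
have [->|a0] := eqVneq a 0; first by rewrite conjC0 conjc0.
apply: (mulfI a0); rewrite -normCK.
by rewrite sqr_normc.
Qed.

Lemma conjM (a b : R[i]) : (a * b)^*%R = a^*%R * b^*%R.
Proof. exact: rmorphM. Qed.

Lemma conjR (r : R) : (r%:C)^*%R = r%:C.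
Proof. by rewrite conjCE conjc_real. Qed.

Lemma mul_conj (a : R[i]) : a * a^*%R = (nrm a ^+ 2)%:C.
Proof. by rewrite -normCK nrmE rmorphXn. Qed.

End Norm.

Section Inner.
Variables (R : realType) (H : hilbertType R).
Implicit Types (x y z : H) (a : R[i]).

Lemma innerC x y : inner x y = (inner y x)^*%R.
Proof. by rewrite hermC /= expr0 mul1r. Qed.

Lemma innerDl x y z : inner (x + y) z = inner x z + inner y z.
Proof. exact: linearDl. Qed.

Lemma innerDr x y z : inner z (x + y) = inner z x + inner z y.
Proof. exact: linearDr. Qed.

Lemma innerNl x z : inner (- x) z = - inner x z.
Proof. exact: linearNl. Qed.

Lemma innerNr x z : inner z (- x) = - inner z x.
Proof. exact: linearNr. Qed.

Lemma innerBl x y z : inner (x - y) z = inner x z - inner y z.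
Proof. by rewrite innerDl innerNl. Qed.

Lemma innerBr x y z : inner z (x - y) = inner z x - inner z y.
Proof. by rewrite innerDr innerNr. Qed.

Lemma innerZl a x z : inner (a *: x) z = a * inner x z.
Proof. exact: linearZl_LR. Qed.

Lemma innerZr a x z : inner z (a *: x) = a^*%R * inner z x.
Proof. exact: linearZr_LR. Qed.

Lemma inner0l z : inner (0 : H) z = 0.
Proof. by rewrite -[0](subrr (0 : H)) innerBl subrr. Qed.

Lemma inner0r z : inner z (0 : H) = 0.
Proof. by rewrite -[0](subrr (0 : H)) innerBr subrr. Qed.

Lemma inner_nrm x : inner x x = (nrm x ^+ 2)%:C.
Proof. by rewrite -sqr_norm_inner nrmE rmorphXn. Qed.

Lemma sqr_nrm x : nrm x ^+ 2 = complex.Re (inner x x).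
Proof. by rewrite inner_nrm. Qed.

Lemma inner_eq0 x : inner x x = 0 -> x = 0.
Proof.
rewrite inner_nrm => /complexI/eqP; rewrite sqrf_eq0 => /eqP.
exact: nrm_eq0.
Qed.

Lemma inner_injr x y : (forall z, inner z x = inner z y) -> x = y.
Proof.
by move=> h; apply/subr0_eq/inner_eq0; rewrite innerBr h subrr.
Qed.

Lemma sqr_nrmD x y :
  nrm (x + y) ^+ 2 = nrm x ^+ 2 + nrm y ^+ 2 + 2 * complex.Re (inner x y).
Proof.
rewrite !sqr_nrm !(innerDl, innerDr) (innerC y x) conjCE !raddfD /=.
by case: (inner x y) => a b /=; ring.
Qed.

Lemma sqr_nrmB x y :
  nrm (x - y) ^+ 2 = nrm x ^+ 2 + nrm y ^+ 2 - 2 * complex.Re (inner x y).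
Proof. by rewrite sqr_nrmD nrmN innerNr raddfN /= mulrN. Qed.

Lemma cauchy_schwarz x y : nrm (inner x y) <= nrm x * nrm y.
Proof.
have [/nrm_eq0 ->|y0] := eqVneq (nrm y) 0.
  by rewrite inner0r !nrm0 mulr0.
have py : 0 < nrm y by rewrite lt_def y0 nrm_ge0.
pose a := inner x y / (nrm y ^+ 2)%:C.
have py2 : (nrm y ^+ 2)%:C != 0 by rewrite (inj_eq (@complexI R)) expf_neq0.
have h : 0 <= nrm (x - a *: y) ^+ 2 by rewrite sqr_ge0.
have e : nrm (x - a *: y) ^+ 2 * nrm y ^+ 2
   = nrm x ^+ 2 * nrm y ^+ 2 - nrm (inner x y) ^+ 2.
  have e2 : (nrm (inner x y) ^+ 2)%:C = inner x y * (inner x y)^*%R.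
    by rewrite rmorphXn /= -nrmE normCK.
  suff : inner (x - a *: y) (x - a *: y) * inner y y =
      inner x x * inner y y - inner x y * (inner x y)^*%R.
    by rewrite !inner_nrm -e2 -!rmorphM -rmorphB => /complexI.
  rewrite innerBl !innerBr !innerZl !innerZr (innerC y x).
  rewrite /a -inner_nrm rmorphM fmorphV /= -(innerC y y).
  set p := inner x y; set q := inner y y.
  have q0 : q != 0 by rewrite /q inner_nrm.
  by field.
have : 0 <= (nrm x * nrm y) ^+ 2 - nrm (inner x y) ^+ 2.
  by rewrite exprMn -e mulr_ge0 ?sqr_ge0.
by rewrite subr_ge0 ler_sqr ?nnegrE ?mulr_ge0 ?nrm_ge0.
Qed.

End Inner.

(** * Closure, completeness and orthogonal projection *)

Section Topology.
Variable R : realType.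

Lemma ballP (U : normedModType R[i]) (x y : U) (e : R) :
  ball x e%:C y <-> nrm (x - y) < e.
Proof. by rewrite -ball_normE /ball_/= nrmE ltcR. Qed.

Lemma posC (e : R[i]) : 0 < e -> exists2 r : R, 0 < r & e = r%:C.
Proof.
move=> e0; have /complex_realP[k ke] : e \is Num.real by rewrite gtr0_real.
by exists k => //; rewrite -ltcR -ke.
Qed.

Lemma closureP (U : normedModType R[i]) (A : set U) x :
  closure A x <-> forall e : R, 0 < e -> exists2 a, A a & nrm (x - a) < e.
Proof.
split=> [h e e0|h B /nbhs_ballP[e' /= /posC[e e0 ->] eB]].
  have [|a [Aa /ballP]] := h (ball x e%:C); last by exists a.
  by apply: nbhsx_ballx; rewrite ltcR.
by have [a Aa /ballP xa] := h _ e0; exists a; split => //; exact: eB.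
Qed.

Lemma closureP2 (U V : normedModType R[i]) (A : set (U * V)) x y :
  closure A (x, y) <-> forall e : R, 0 < e ->
    exists a b, [/\ A (a, b), nrm (x - a) < e & nrm (y - b) < e].
Proof.
split=> [h e e0|h B /nbhs_ballP[e' /= /posC[e e0 ->] eB]].
  have [|[a b] [Aa [/ballP xa /ballP yb]]] := h (ball (x, y) e%:C).
    by apply: nbhsx_ballx; rewrite ltcR.
  by exists a, b.
have [a [b [Aab /ballP xa /ballP yb]]] := h _ e0.
by exists (a, b); split => //; exact: eB.
Qed.

(** Approximations are chosen with error [1/(n+1)], so that limits come with an explicit rate and
    later estimates stay inequalities between real numbers. *)
Definition rate (n : nat) : R := n.+1%:R^-1.

Lemma rate_gt0 n : 0 < rate n.
Proof. by rewrite invr_gt0. Qed.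

Lemma rate_le m n : (m <= n)%N -> rate n <= rate m.
Proof. by move=> mn; rewrite lef_pV2 ?posrE // ler_nat ltnS. Qed.

Lemma rate_small (e : R) : 0 < e -> exists n, rate n < e.
Proof.
move=> e0; exists (Num.Def.truncn e^-1).
by rewrite /rate -[ltRHS]invrK ltf_pV2 ?posrE ?invr_gt0// truncnS_gt.
Qed.

Lemma complete_rate (U : completeNormedModType R[i]) (x : nat -> U) (K : R) :
  (forall m n, nrm (x m - x n) <= K * (rate m + rate n)) ->
  exists l, forall n, nrm (x n - l) <= K * rate n.
Proof.
move=> h.
have K0 : 0 <= K.
  by have := le_trans (nrm_ge0 _) (h 0 0); rewrite pmulr_lge0// addr_gt0// rate_gt0.
have cx : cvg (x @ \oo).
  apply/cauchy_cvgP/cauchyP => _ /posC[e e0 ->].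
  have K1 : 0 < K + 1 by rewrite ltr_wpDl.
  have [N hN] := rate_small (divr_gt0 e0 (mulr_gt0 K1 (ltr0Sn R 1))).
  exists (x N); exists N => // n /= Nn; apply/ballP.
  apply: le_lt_trans (h _ _) _.
  have rn : rate n <= rate N by exact: rate_le.
  move: hN; rewrite ltr_pdivlMr ?mulr_gt0// => hN.
  have := rate_gt0 N; have := rate_gt0 n.
  by nra.
exists (lim (x @ \oo)) => n; apply/ler_addgt0Pr => e e0.
have /cvgrPdist_lt /(_ (e / 2)%:C) := cx.
rewrite ltcR divr_gt0// => /(_ isT)[N1 _ hN1].
have K1 : 0 < K + 1 by rewrite ltr_wpDl.
have [N2 hN2] := rate_small (divr_gt0 e0 (mulr_gt0 K1 (ltr0Sn R 1))).
set N := maxn N1 N2.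
have /= := hN1 N (leq_maxl _ _); rewrite nrmE ltcR => a1.
have a2 := h n N.
apply: le_trans (nrm_triangle (x N) _ _) _.
rewrite (nrm_dist (x N)).
move: hN2; rewrite ltr_pdivlMr ?mulr_gt0// => hN2.
have rn : rate N <= rate N2 by apply: rate_le; exact: leq_maxr.
have := rate_gt0 N; have := rate_gt0 n.
by nra.
Qed.

Variables (U V : hilbertType R).

Lemma submodP (W : lmodType R[i]) (A : set W) : submod_closed (mem A) ->
  [/\ A 0, forall x y, A x -> A y -> A (x + y), forall x y, A x -> A y -> A (x - y)
    & forall a x, A x -> A (a *: x)].
Proof.
move=> [A0 AL].
have h a x y : A x -> A y -> A (a *: x + y).
  by move=> Ax Ay; exact: set_mem (AL a x y (mem_set Ax) (mem_set Ay)).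
have A00 : A 0 by exact: set_mem A0.
split=> // [x y Ax Ay|x y Ax Ay|a x Ax].
- by rewrite -[x]scale1r; exact: h.
- by rewrite -scaleN1r addrC; exact: h.
- by rewrite -[_ *: _]addr0; exact: h.
Qed.

Lemma submod2P (W X : lmodType R[i]) (A : set (W * X)) : submod_closed (mem A) ->
  [/\ A (0, 0),
      forall x y x' y', A (x, y) -> A (x', y') -> A (x + x', y + y'),
      forall x y x' y', A (x, y) -> A (x', y') -> A (x - x', y - y')
    & forall a x y, A (x, y) -> A (a *: x, a *: y)].
Proof.
move=> /submodP[A0 AD AB AZ]; split=> // [x y x' y'|x y x' y'|a x y].
- exact: (AD (x, y) (x', y')).
- exact: (AB (x, y) (x', y')).
- exact: (AZ a (x, y)).
Qed.

Lemma linear_funP (W X : lmodType R[i]) (T : W -> X) : linear T ->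
  [/\ T 0 = 0, {morph T : x y / x + y}, {morph T : x y / x - y}
    & forall a, {morph T : x / a *: x}].
Proof.
move=> lT; pose TL : {linear W -> X} := HB.pack T (GRing.isLinear.Build _ _ _ _ _ lT).
split; [exact: linear0 TL|exact: linearD TL|exact: linearB TL|exact: linearZ_LR TL].
Qed.

Lemma submodI (W : lmodType R[i]) (A : set W) : A 0 ->
  (forall a x y, A x -> A y -> A (a *: x + y)) -> submod_closed (mem A).
Proof.
move=> A0 h; split=> [|a x y /set_mem Ax /set_mem Ay]; apply: mem_set => //.
exact: h.
Qed.

(** By the bound, the second components of an approximating sequence are Cauchy along with the
    first; closedness of [A] then supplies the limit pair. *)
Lemma closed_reldom (A : set (U * V)) (m : R) : closed_relation A ->
  (forall x y, A (x, y) -> nrm y <= m * nrm x) -> closed (reldom A).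
Proof.
move=> [/submodP[_ _ AB _] Acl] h x /closureP xA.
have {}xA n : exists p : U * V, A p /\ nrm (x - p.1) < rate n.
  have [a [b Aab] xa] := xA _ (rate_gt0 n).
  by exists (a, b).
have [f hf] := choice xA.
have fB j k : nrm ((f j).2 - (f k).2) <= `|m| * nrm ((f j).1 - (f k).1).
  have /h : A ((f j).1 - (f k).1, (f j).2 - (f k).2).
    apply: (AB ((f j).1, (f j).2) ((f k).1, (f k).2));
    by rewrite -surjective_pairing; case: (hf j) (hf k) => + _ [].
  move=> /le_trans; apply; rewrite ler_wpM2r ?nrm_ge0//; exact: ler_norm.
have [|l hl] := @complete_rate V (fun n => (f n).2) `|m|.
  move=> j k; apply: le_trans (fB _ _) _; rewrite ler_wpM2l//.
  apply: le_trans (nrm_triangle x _ _) _.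
  rewrite (nrm_dist _ x); apply: lerD; apply: ltW; [exact: (hf j).2|exact: (hf k).2].
exists l; apply: Acl; apply/closureP2 => e e0.
have m0 : 0 < `|m| + 1 by rewrite ltr_wpDl.
have [n hn] := rate_small (divr_gt0 e0 m0).
exists (f n).1, (f n).2; split; first by rewrite -surjective_pairing; exact: (hf n).1.
  apply: lt_trans (hf n).2 _; apply: lt_le_trans hn _.
  by rewrite ler_pdivrMr// ler_peMr ?(ltW e0)// lerDr.
rewrite nrm_dist; apply: le_lt_trans (hl n) _.
move: hn; rewrite ltr_pdivlMr// mulrC; apply: le_lt_trans.
by rewrite ler_wpM2r ?lerDl// ltW// rate_gt0.
Qed.

Lemma ortho_projection (M : set U) : submod_closed (mem M) -> closed M ->
  forall p, exists2 m, M m & forall z, M z -> inner (p - m) z = 0.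
Proof.
move=> /submodP[M0 MD MB MZ] Mcl p.
pose E := [set nrm (p - m) ^+ 2 | m in M].
have Ei : has_inf E.
  split; first by exists (nrm (p - 0) ^+ 2), 0.
  by exists 0 => _ [m _ <-]; exact: sqr_ge0.
set d := inf E.
have dE m : M m -> d <= nrm (p - m) ^+ 2.
  by move=> Mm; apply: ge_inf; [case: Ei | exists m].
have d0 : 0 <= d.
  by apply: lb_le_inf; [case: Ei | move=> _ [m _ <-]; exact: sqr_ge0].
(* The excess over the infimum is squared because the parallelogram identity below bounds squared
   distances; this gives [|m_j - m_k| <= 2 (rate j + rate k)]. *)
have hm n : exists m, M m /\ nrm (p - m) ^+ 2 < d + rate n ^+ 2.
  have [|_ [m Mm <-] lt] := @inf_adherent _ E (rate n ^+ 2) _ Ei.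
    by rewrite exprn_gt0// rate_gt0.
  by exists m.
have [m {}hm] := choice hm.
have [j k|l hl] := @complete_rate U m 2.
  have pj : nrm (m j - m k) ^+ 2 = 2 * nrm (p - m j) ^+ 2 + 2 * nrm (p - m k) ^+ 2
      - 4 * nrm (p - 2^-1%:C *: (m j + m k)) ^+ 2.
    rewrite -[4](_ : (2%:R * 2%:R) = _); last by ring.
    have e : (p - m j) + (p - m k) = 2%:C *: (p - 2^-1%:C *: (m j + m k)).
      rewrite scalerBr scalerA -rmorphM /= mulfV// scale1r.
      rewrite [_%:C](_ : _ = 1 + 1); last by rewrite rmorphD.
      by rewrite scalerDl scale1r addrACA opprD.
    have := sqr_nrmD (p - m j) (p - m k).
    have := sqr_nrmB (p - m j) (p - m k).
    rewrite e nrmZ nrmC ger0_norm// exprMn.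
    have -> : p - m j - (p - m k) = m k - m j by rewrite opprB addrC addrA subrK.
    rewrite (nrm_dist (m k)); lra.
  have := dE (2^-1%:C *: (m j + m k)) (MZ _ _ (MD _ _ (hm j).1 (hm k).1)).
  have := (hm j).2; have := (hm k).2.
  have := rate_gt0 j; have := rate_gt0 k => r1 r2 h1 h2 h3.
  have : nrm (m j - m k) ^+ 2 <= (2 * (rate j + rate k)) ^+ 2 by nra.
  by rewrite ler_sqr ?nnegrE ?nrm_ge0// mulr_ge0// addr_ge0// ltW.
have Ml : M l.
  apply: Mcl; apply/closureP => e e0.
  have [n hn] := rate_small (divr_gt0 e0 (ltr0Sn R 1)).
  exists (m n); first exact: (hm n).1.
  rewrite nrm_dist; apply: le_lt_trans (hl n) _.
  by move: hn; rewrite ltr_pdivlMr// mulrC.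
have ld : nrm (p - l) ^+ 2 <= d.
  apply/ler_addgt0Pr => e e0.
  have D0 : 0 < 5 + 4 * (d + 2) by lra.
  have [n hn] := rate_small (divr_gt0 e0 D0).
  have := nrm_triangle (m n) p l; have := (hm n).2; have := hl n.
  move: hn; rewrite ltr_pdivlMr// => hn.
  have := nrm_ge0 (p - l); have := nrm_ge0 (p - m n); have := nrm_ge0 (m n - l).
  have := rate_gt0 n.
  have r1 : rate n <= 1 by have := rate_le (leq0n n); rewrite {2}/rate invr1.
  set a := nrm (p - l); set b := nrm (p - m n); set c := nrm (m n - l).
  set r := rate n in hn r1 * => r0 c0 b0 a0 cr bd abc.
  have b1 : b <= d + 2 by nra.
  have : a ^+ 2 <= (b + 2 * r) ^+ 2 by rewrite ler_sqr ?nnegrE; nra.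
  nra.
exists l => // z Mz; apply: nrm_eq0.
set w := p - l; set c := inner w z.
(* Moving [l] by [t c z] changes the squared distance by [t^2 |c|^2 |z|^2 - 2 t |c|^2], which is
   negative for this [t] unless [c = 0]; the added 1 also covers [z = 0]. *)
pose t : R := (nrm z ^+ 2 + 1)^-1.
have z0 : 0 < nrm z ^+ 2 + 1 by rewrite ltr_wpDl// sqr_ge0.
have tz : t * (nrm z ^+ 2 + 1) = 1 by rewrite mulVf// gt_eqF.
have t0 : 0 < t by rewrite invr_gt0.
have := dE (l + (t%:C * c) *: z) (MD _ _ Ml (MZ _ _ Mz)).
have -> : p - (l + (t%:C * c) *: z) = w - (t%:C * c) *: z by rewrite opprD addrA.
rewrite sqr_nrmB nrmZ innerZr -/c nrmM nrmC gtr0_norm//.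
have -> : complex.Re ((t%:C * c)^*%R * c) = t * nrm c ^+ 2.
  by rewrite conjM conjR -mulrA [_^*%R * _]mulrC mul_conj -rmorphM.
move=> h; apply/eqP; rewrite -sqrf_eq0; apply/eqP/le_anti.
rewrite sqr_ge0 andbT.
move: ld; rewrite -/w.
nra.
Qed.

End Topology.

(** * Growth and positivity *)

Section HilbertTools.
Variable R : realType.
Implicit Types U V : hilbertType R.

Lemma closed_full U (M : set U) : submod_closed (mem M) -> closed M ->
  (forall w, (forall z, M z -> inner w z = 0) -> w = 0) -> forall x, M x.
Proof.
move=> Ms Mc h x; have [m Mm xm] := ortho_projection Ms Mc x.
by rewrite (subr0_eq (h _ xm)).
Qed.

Lemma pow_bounded (q C : R) : 0 <= q -> (forall n, q ^+ n <= C) -> q <= 1.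
Proof.
move=> q0 h; rewrite leNgt; apply/negP => q1.
have b n : 1 + (q - 1) *+ n <= q ^+ n.
  elim: n => [|n IH]; first by rewrite mulr0n addr0 expr0.
  rewrite exprS mulrS; have : 0 <= (q - 1) *+ n by rewrite mulrn_wge0// subr_ge0 ltW.
  nra.
have q1' : 0 < q - 1 by rewrite subr_gt0.
have C0 : 0 <= C by apply: le_trans (h 0); rewrite expr0.
have [n hn] := rate_small (divr_gt0 q1' (ltr_wpDl C0 ltr01)).
move: hn; rewrite /rate ltr_pdivlMr ?(ltr_wpDl C0)// mulrC ltr_pdivrMr//.
have := b n.+1; have := h n.+1; rewrite -mulr_natr; lra.
Qed.

(* The Hankel structure gives [|u_k|^2 = |<u_(2k), u_0>| <= |u_(2k)| |u_0|], so the
   growth rate of the moments bounds the first step. *)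
Lemma hankel_growth U (u : nat -> U) (c C : R) : 0 <= c ->
  (forall j k, inner (u j.+1) (u k) = inner (u j) (u k.+1)) ->
  (forall n, nrm (inner (u n) (u 0%N)) <= C * c ^+ n) ->
  nrm (u 1%N) <= c * nrm (u 0%N).
Proof.
move=> c0 hu hC.
have hank j k : inner (u j) (u k) = inner (u (j + k)%N) (u 0%N).
  by elim: k j => [|k IH] j; [rewrite addn0 | rewrite -hu IH addSnnS].
have sq k : nrm (u k) ^+ 2 = nrm (inner (u (k + k)%N) (u 0%N)).
  by rewrite -hank inner_nrm nrmC ger0_norm ?sqr_ge0.
have dbl k : nrm (u k) ^+ 2 <= nrm (u (k + k)%N) * nrm (u 0%N).
  by rewrite sq; exact: cauchy_schwarz.
have [b0|b0] := eqVneq (nrm (u 0%N)) 0.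
  have := dbl 1%N; rewrite b0 !mulr0 => h.
  by rewrite -(@ler_sqr _ (nrm _)) ?nnegrE ?nrm_ge0// expr0n.
have pb : 0 < nrm (u 0%N) by rewrite lt_def b0 nrm_ge0.
set b := nrm (u 0%N) in b0 pb dbl *.
(* Each use of [dbl] doubles the index and squares the ratio to [b], so no constant accumulates. *)
have pow n : (nrm (u 1%N) / b) ^+ (2 ^ n) <= nrm (u (2 ^ n)%N) / b.
  elim: n => [|n IH]; first by rewrite expn0 expr1.
  rewrite expnS mulnC exprM.
  apply: le_trans (_ : (nrm (u (2 ^ n)%N) / b) ^+ 2 <= _).
    by rewrite lerXn2r ?nnegrE ?exprn_ge0 ?divr_ge0 ?nrm_ge0// ltW.
  rewrite expr_div_n ler_pdivrMr ?exprn_gt0// (le_trans (dbl _))//.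
  by rewrite addnn -muln2 expr2 mulrA divfK// mulrC.
rewrite -ler_pdivrMr//; set q := _ / b.
have q0 : 0 <= q by rewrite divr_ge0 ?nrm_ge0// ltW.
have key n : q ^+ (2 ^ n.+1) <= C / b ^+ 2 * c ^+ (2 ^ n.+1).
  rewrite expnS mulnC exprM.
  apply: le_trans (_ : (nrm (u (2 ^ n)%N) / b) ^+ 2 <= _).
    by rewrite lerXn2r ?nnegrE ?exprn_ge0 ?divr_ge0 ?nrm_ge0// ltW.
  rewrite expr_div_n sq addnn -muln2 mulrAC ler_pM2r ?invr_gt0 ?exprn_gt0//.
case: (eqVneq c 0) => [cz|cn0].
  have := key 0%N; rewrite cz expn1 expr0n mulr0 => h.
  by rewrite -(@ler_sqr _ q) ?nnegrE// expr0n.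
have cp : 0 < c by rewrite lt_def cn0.
rewrite -[c]mul1r -ler_pdivrMr//.
(* [key] controls only the exponents [2^(n+1)]. For [q / c > 1] they dominate the exponent [n]; for
   [q / c <= 1] the added 1 is a bound. *)
apply: (@pow_bounded _ (C / b ^+ 2 + 1)); first by rewrite divr_ge0.
move=> n; have [r1|r1] := leP (q / c) 1.
  have q1 : (q / c) ^+ n <= 1.
    by apply: exprn_ile1; [exact: divr_ge0 q0 (ltW cp)|exact: r1].
  apply: le_trans q1 _; rewrite lerDr divr_ge0 ?sqr_ge0//.
  by apply: le_trans (nrm_ge0 _) (le_trans (hC 0%N) _); rewrite expr0 mulr1.
apply: le_trans (_ : (q / c) ^+ (2 ^ n.+1) <= _).
  by rewrite ler_eXn2l//; exact: leq_trans (leqnSn n) (ltnW (ltn_expl n.+1 (ltnSn 1))). 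
rewrite expr_div_n ler_pdivrMr ?exprn_gt0//; apply: le_trans (key n) _.
by rewrite ler_wpM2r ?exprn_ge0// lerDl.
Qed.

(** The form is evaluated at [x - b^-1 T x]: the mixed terms are [-2 b^-1 |T x|^2], and the
    quadratic term is at most [b^-1 |T x|^2]. *)
Lemma positive_form_bound U (T : U -> U) (b : R) : 0 <= b -> linear T ->
  (forall x y, inner (T x) y = inner x (T y)) ->
  (forall x, 0 <= complex.Re (inner (T x) x)) ->
  (forall x, nrm (T x) <= b * nrm x) ->
  forall x, nrm (T x) ^+ 2 <= b * complex.Re (inner (T x) x).
Proof.
move=> b0 lT sT pT bT x.
have [b00|bn0] := eqVneq b 0.
  have := bT x; rewrite b00 !mul0r => h.
  have -> : nrm (T x) = 0 by apply/le_anti; rewrite h nrm_ge0.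
  by rewrite expr0n.
have bp : 0 < b by rewrite lt_def bn0.
have tb : b^-1 * b = 1 by rewrite mulVf.
have t0 : 0 < b^-1 by rewrite invr_gt0.
have [_ _ TB TZ] := linear_funP lT.
have := pT (x - (b^-1)%:C *: T x).
rewrite TB TZ innerBl !innerBr !innerZl !innerZr conjR (sT (T x) x) inner_nrm.
have := bT (T x); have := cauchy_schwarz (T (T x)) (T x).
have := Re_le_nrm (inner (T (T x)) (T x)).
case: (inner (T (T x)) (T x)) => p1 p2 /=.
case: (inner (T x) x) => q1 q2 /= h1 h2 h3.
rewrite !(mul0r, mulr0, subr0, oppr0, add0r, addr0).
set N := nrm (T x) in h2 h3 *; have N0 : 0 <= N by exact: nrm_ge0.
have {h1 h2 h3} : p1 <= b * N ^+ 2 by nra.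
set t := b^-1 in t0 tb *.
move=> h1 h2.
have h3 : t * (t * p1) <= t * N ^+ 2.
  rewrite ler_pM2l//; have : t * p1 <= t * (b * N ^+ 2) by rewrite ler_pM2l.
  by rewrite mulrA tb mul1r.
have : t * N ^+ 2 <= q1 by lra.
by rewrite mulrC ler_pdivrMr// mulrC.
Qed.

(** The square expands to [b^2 |x|^2 + |T x|^2 - 2 b <T x, x>], and [positive_form_bound] absorbs
    [|T x|^2]. Positivity thereby becomes a norm inequality, the kind of statement that
    [hankel_growth] transports. *)
Lemma positive_form_shift U (T : U -> U) (b : R) : 0 <= b -> linear T ->
  (forall x y, inner (T x) y = inner x (T y)) ->
  (forall x, 0 <= complex.Re (inner (T x) x)) ->
  (forall x, nrm (T x) <= b * nrm x) ->
  forall x, nrm (b%:C *: x - T x) <= b * nrm x.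
Proof.
move=> b0 lT sT pT bT x.
have h := positive_form_bound b0 lT sT pT bT x.
rewrite -ler_sqr ?nnegrE ?nrm_ge0 ?mulr_ge0 ?nrm_ge0//.
rewrite sqr_nrmB nrmZ nrmC ger0_norm// innerZl -sT.
have := pT x; case: (inner (T x) x) h => p1 p2 /=.
rewrite mul0r subr0; nra.
Qed.

Lemma form_of_shift U (T : U -> U) (b : R) x : 0 <= b ->
  nrm (b%:C *: x - T x) <= b * nrm x -> 0 <= complex.Re (inner (T x) x).
Proof.
move=> b0 h; have := Re_le_nrm (inner (b%:C *: x - T x) x).
have := cauchy_schwarz (b%:C *: x - T x) x.
rewrite innerBl innerZl inner_nrm; have := nrm_ge0 x.
set v := inner (T x) x; rewrite raddfB /= mul0r subr0; nra.
Qed.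

Lemma bounded_operatorP U V (T : U -> V) : bounded_operator T <->
  linear T /\ exists2 m : R, 0 <= m & forall x, nrm (T x) <= m * nrm x.
Proof.
split=> [[lT cT]|[lT [m m0 hm]]]; split=> //.
  pose TL : {linear U -> V} := HB.pack T (GRing.isLinear.Build _ _ _ _ _ lT).
  have cTL : continuous TL by [].
  have /linear_boundedP/pinfty_ex_gt0[_ /posC[m m0 ->] hm] :=
    (linear_bounded_continuous TL).2 cTL.
  exists m => [|x]; first exact: ltW.
  by have := hm x; rewrite !nrmE -rmorphM lecR.
pose TL : {linear U -> V} := HB.pack T (GRing.isLinear.Build _ _ _ _ _ lT).
apply: (linear_bounded_continuous TL).1; apply/linear_boundedP.
exists m%:C; split=> [|r mr x]; first by apply/complex_realP; exists m.
apply: le_trans (_ : m%:C * `|x| <= _); first by rewrite !nrmE -rmorphM lecR.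
by rewrite ler_wpM2r// ltW.
Qed.

(* Gliding hump: if [T] is unbounded, then so is [T'] on the unit ball, and a series of
   steps of length [3^-n] along [T' (y n)] converges to an [l] for which
   [<l, T' (y n)> = <T l, y n>] is unbounded. *)
Lemma hellinger_toeplitz U V (T : U -> V) (T' : V -> U) :
  (forall x y, inner (T x) y = inner x (T' y)) ->
  exists2 m : R, 0 <= m & forall x, nrm (T x) <= m * nrm x.
Proof.
move=> hT; apply: contrapT => nb.
have big (n : nat) : exists y : V, nrm y <= 1 /\ 4 ^+ n <= nrm (T' y).
  apply: contrapT => ny; apply: nb; exists (4 ^+ n) => [|x]; first exact: exprn_ge0.
  have [T0|T0] := eqVneq (nrm (T x)) 0.
    by rewrite T0 mulr_ge0 ?exprn_ge0 ?nrm_ge0.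
  have Tp : 0 < nrm (T x) by rewrite lt_def T0 nrm_ge0.
  pose y := (nrm (T x))^-1%:C *: T x.
  have y1 : nrm y <= 1 by rewrite nrmZ nrmC ger0_norm ?invr_ge0 ?nrm_ge0// mulVf.
  have T'y : nrm (T' y) <= 4 ^+ n.
    by apply/ltW; rewrite ltNge; apply/negP => h; apply: ny; exists y.
  have e : nrm (T x) = nrm (inner x (T' y)).
    rewrite -hT innerZr conjR inner_nrm nrmM !nrmC.
    rewrite !ger0_norm ?sqr_ge0 ?invr_ge0 ?nrm_ge0//.
    by rewrite expr2 mulrA mulVf ?mul1r.
  rewrite e; apply: le_trans (cauchy_schwarz _ _) _.
  by rewrite mulrC ler_wpM2r ?nrm_ge0.
have [y hy] := choice big; pose z n := T' (y n).
pose r n : R := 3^-1 ^+ n.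
have r0 n : 0 < r n by rewrite exprn_gt0// invr_gt0.
have zp n : 0 < nrm (z n).
  by apply: lt_le_trans (hy n).2; rewrite exprn_gt0.
(* [2 <h, z>] is the difference of [<x + h, z>] and [<x - h, z>], so one of the two has modulus at
   least [|<h, z>| = r n * |z n|]. *)
have step (p : nat * U) : exists x', nrm (x' - p.2) <= r p.1 /\
    r p.1 * nrm (z p.1) <= nrm (inner x' (z p.1)).
  case: p => n x /=.
  pose h := (r n / nrm (z n))%:C *: z n.
  have hn : nrm h = r n.
    by rewrite nrmZ nrmC ger0_norm ?divr_ge0 ?nrm_ge0 ?(ltW (r0 _))// divfK// gt_eqF ?zp.
  have hz : nrm (inner h (z n)) = r n * nrm (z n).
    rewrite innerZl inner_nrm nrmM !nrmC.
    rewrite !ger0_norm ?sqr_ge0 ?divr_ge0 ?nrm_ge0 ?(ltW (r0 _))//.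
    by rewrite expr2 mulrA divfK// gt_eqF ?zp.
  have [le1|lt1] := leP (r n * nrm (z n)) (nrm (inner (x + h) (z n))).
    by exists (x + h); rewrite addrAC subrr add0r hn.
  exists (x - h); rewrite addrAC subrr add0r nrmN hn; split=> //.
  have : inner h (z n) + inner h (z n) = inner (x + h) (z n) - inner (x - h) (z n).
    by rewrite innerBl innerDl; ring.
  move/(congr1 (@nrm R _)) => e.
  have := nrmB (inner (x + h) (z n)) (inner (x - h) (z n)).
  rewrite -e (_ : inner h (z n) + inner h (z n) = 2%:C * inner h (z n)); last first.
    by rewrite (rmorphD _ 1 1) mulrDl mul1r.
  rewrite nrmM nrmC ger0_norm// hz; lra.
have [f hf] := choice step.
pose x := fix x n := if n is m.+1 then f (m, x m) else 0.
have xS n : nrm (x n.+1 - x n) <= r n := (hf (n, x n)).1.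
have rS n : r n.+1 = r n / 3 by rewrite /r exprSr.
have xk k j : nrm (x (k + j)%N - x k) <= 3 / 2 * (r k - r (k + j)%N).
  elim: j => [|j IH]; first by rewrite addn0 !subrr mulr0 nrm0.
  rewrite addnS rS; apply: le_trans (nrm_triangle (x (k + j)%N) _ _) _.
  have := xS (k + j)%N; lra.
have rr n : r n <= rate R n.
  rewrite /r /rate exprVn lef_pV2 ?posrE ?exprn_gt0//.
  by rewrite -natrX ler_nat ltn_expl.
have xc m n : nrm (x m - x n) <= 3 / 2 * (rate R m + rate R n).
  wlog mn : m n / (m <= n)%N.
    move=> h; have [/h//|/ltnW/h] := leqP m n.
    by rewrite nrm_dist [rate R m + _]addrC.
  rewrite nrm_dist -(subnKC mn); apply: le_trans (xk _ _) _.
  rewrite ler_pM2l//; have := rr m; have := r0 (m + (n - m))%N.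
  have := rate_gt0 R (m + (n - m)%N); lra.
have [l hl] := complete_rate xc.
have xl n : nrm (x n - l) <= 3 / 2 * r n.
  apply/ler_addgt0Pr => e e0.
  have [m hm] := rate_small (divr_gt0 e0 (ltr0Sn R 1)).
  apply: le_trans (nrm_triangle (x (n + m)%N) _ _) _.
  have := xk n m; rewrite (nrm_dist (x n)).
  have := hl (n + m)%N; have := rate_le R (leq_addl n m); have := r0 (n + m)%N.
  move: hm; rewrite ltr_pdivlMr//; lra.
(* The steps after [n + 1] sum to [r n / 2] and cost half of [r n * |z n|]; the other half, at least
   [(4/3)^n / 2], is bounded by [|T l|]. *)
have : (4 / 3 : R) <= 1.
  apply: (@pow_bounded _ (2 * nrm (T l))) => // n.
  have h1 : nrm (inner l (z n)) <= nrm (T l).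
    rewrite -hT; apply: le_trans (cauchy_schwarz _ _) _.
    by rewrite ler_piMr ?nrm_ge0//; exact: (hy n).1.
  have h2 := (hf (n, x n)).2; rewrite /= -/(x n.+1) in h2.
  have h3 : nrm (inner (x n.+1 - l) (z n)) <= 3 / 2 * (r n / 3) * nrm (z n).
    apply: le_trans (cauchy_schwarz _ _) _.
    by rewrite ler_wpM2r ?nrm_ge0// -rS.
  have h4 : nrm (inner (x n.+1) (z n)) <=
      nrm (inner (x n.+1 - l) (z n)) + nrm (inner l (z n)).
    by apply: le_trans (nrmD _ _); rewrite -innerDl subrK.
  have h5 : (4 / 3) ^+ n <= r n * nrm (z n).
    by rewrite exprMn mulrC ler_pM2l//; exact: (hy n).2.
  lra.
by rewrite ler_pdivrMr// mul1r ler_nat.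
Qed.

Lemma adjoint_closed U V (A : set (U * V)) : closed_relation (adjoint A).
Proof.
split.
  apply: submodI => [p Ap|a x y hx hy p Ap].
    by rewrite inner0r inner0r.
  by rewrite /= !(innerDr, innerZr) hx// hy.
move=> [x y] /closureP2 h p Ap /=; apply/subr0_eq.
apply: (@nrm_small _ _ _ (nrm p.1 + nrm p.2)) => e e0.
have [a [b [Aab xa yb]]] := h _ e0.
have -> : inner p.2 x - inner p.1 y = inner p.2 (x - a) - inner p.1 (y - b).
  by rewrite !innerBr (Aab p Ap) /=; ring.
apply: le_trans (nrmB _ _) _; rewrite mulrDr addrC; apply: lerD.
  apply: le_trans (cauchy_schwarz _ _) _; rewrite mulrC ler_wpM2r ?nrm_ge0//.
  exact: ltW.
apply: le_trans (cauchy_schwarz _ _) _; rewrite mulrC ler_wpM2r ?nrm_ge0//.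
exact: ltW.
Qed.

End HilbertTools.

(** * Relations, resolvents and self-adjointness for a modified inner product *)

Section Relations.
Variable R : realType.
Implicit Types U V : hilbertType R.

Lemma graphE U V (T : U -> V) x y : graph T (x, y) <-> y = T x.
Proof. by []. Qed.

Lemma resolventE U (A : set (U * U)) mu h x :
  resolvent A mu (h, x) <-> A (x, h + mu *: x).
Proof.
split=> [[y [z [/= Axy /graphE/= zE ->]]]|Ax]; first by rewrite zE subrK.
by exists (h + mu *: x), (mu *: x); split=> //=; rewrite addrK.
Qed.

Lemma resolvent_graph U (A : set (U * U)) mu (B : U -> U) :
  resolvent A mu = graph B -> forall x y, A (x, y) <-> x = B (y - mu *: x).
Proof.
move=> rB x y.
have : resolvent A mu (y - mu *: x, x) <-> graph B (y - mu *: x, x) by rewrite rB.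
by rewrite resolventE subrK.
Qed.

Lemma resolvent_set_intro U (A : set (U * U)) mu (m : R) : submod_closed (mem A) ->
  0 <= m -> (forall x y, A (x, y) -> nrm x <= m * nrm (y - mu *: x)) ->
  (forall h, exists x, A (x, h + mu *: x)) -> resolvent_set A mu.
Proof.
move=> /submod2P[A0 AD AB AZ] m0 hm hs.
have [B hB] := choice hs.
have uniqB h x : A (x, h + mu *: x) -> x = B h.
  move=> Ax; have /hm := AB _ _ _ _ Ax (hB h).
  have -> : h + mu *: x - (h + mu *: B h) - mu *: (x - B h) = 0.
    by rewrite scalerBr opprD addrACA subrr add0r subrr.
  rewrite nrm0 mulr0 => h0; apply/subr0_eq/nrm_eq0/le_anti.
  by rewrite h0 nrm_ge0.
exists B.
  apply/bounded_operatorP; split=> [a x y|]; last first.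
    by exists m => // x; have := hm _ _ (hB x); rewrite addrK.
  apply/esym/uniqB.
  have := AD _ _ _ _ (AZ a _ _ (hB x)) (hB y).
  by congr (A (_, _)); rewrite !scalerDr !scalerA [mu * a]mulrC addrACA.
apply/seteqP; split=> [[h x] /resolventE/uniqB //|[h x]].
by rewrite /graph/= => ->; apply/resolventE; exact: hB.
Qed.

(** The range of [A - mu] is the domain of its inverse [G], and a lower bound on [A - mu] is an
    upper bound on [G]. *)
Lemma closed_range U (A : set (U * U)) mu (m : R) : closed_relation A -> 0 <= m ->
  (forall x y, A (x, y) -> nrm x <= m * nrm (y - mu *: x)) ->
  submod_closed (mem [set h | exists x, A (x, h + mu *: x)]) /\
  closed [set h | exists x, A (x, h + mu *: x)].
Proof.
move=> [As Ac] m0 hm; have [A0 AD AB AZ] := submod2P As.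
pose G : set (U * U) := [set p | A (p.2, p.1 + mu *: p.2)].
have Gs : submod_closed (mem G).
  apply: submodI => [|a [h x] [k y]]; first by rewrite /G/= scaler0 addr0.
  rewrite /G/= => Ax Ay; have := AD _ _ _ _ (AZ a _ _ Ax) Ay.
  by congr (A (_, _)); rewrite !scalerDr !scalerA [mu * a]mulrC addrACA.
have eG : [set h | exists x, A (x, h + mu *: x)] = reldom G by [].
rewrite eG; split.
  have [G0 GD _ GZ] := submod2P Gs.
  apply: submodI => [|a x y [x' Gx] [y' Gy]]; first by exists 0.
  by exists (a *: x' + y'); exact: GD (GZ a _ _ Gx) Gy.
apply: (@closed_reldom _ _ _ _ m); last first.
  by move=> h x Gx; have := hm _ _ Gx; rewrite addrK.
split=> // -[h x] /closureP2 hcl; apply: Ac; apply/closureP2 => e e0.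
have q0 : 0 < 1 + nrm mu by rewrite ltr_pwDl// nrm_ge0.
have q2 := addr_gt0 q0 q0.
have [k [y [Gky hk xy]]] := hcl _ (divr_gt0 e0 q2).
exists y, (k + mu *: y); split=> //.
  apply: lt_le_trans xy _; rewrite ler_pdivrMr//.
  by rewrite ler_peMr ?(ltW e0)//; have := nrm_ge0 mu; lra.
rewrite /= [X in nrm X](_ : _ = (h - k) + (mu *: x - mu *: y)); last first.
  by rewrite opprD addrACA.
rewrite -scalerBr; apply: le_lt_trans (nrmD _ _) _.
rewrite nrmZ; move: hk xy; rewrite !ltr_pdivlMr//.
have := nrm_ge0 mu; have := nrm_ge0 (h - k); have := nrm_ge0 (x - y).
nra.
Qed.

(** [T] is the Gram operator of an equivalent inner product in which [A] is symmetric: [<y, T x>] is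
    real, so the imaginary part of [<y - mu x, T x>] is [- Im mu <x, T x>]. *)
Lemma symmetric_im_bound U (A : set (U * U)) (T : U -> U) (b c : R) :
  (forall x y, inner (T x) y = inner x (T y)) -> 0 <= b ->
  0 < c -> (forall x, nrm (T x) <= b * nrm x) ->
  (forall x, c * nrm x ^+ 2 <= complex.Re (inner (T x) x)) ->
  (forall x y, A (x, y) -> inner y (T x) = inner x (T y)) ->
  forall (mu : R[i]) x y, A (x, y) ->
    c * `|complex.Im mu| * nrm x <= b * nrm (y - mu *: x).
Proof.
move=> sT b0 c0 bT pT hA mu x y Axy.
have [x0|xn0] := eqVneq (nrm x) 0; first by rewrite x0 mulr0 mulr_ge0 ?nrm_ge0.
have xp : 0 < nrm x by rewrite lt_def xn0 nrm_ge0.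
have yr : complex.Im (inner y (T x)) = 0.
  have : inner y (T x) = (inner y (T x))^*%R.
    by rewrite -innerC sT; exact: hA.
  by rewrite conjCE; case: (inner _ _) => u v /= [] /eqP; rewrite eq_sym eqNr => /eqP.
have xr : complex.Im (inner x (T x)) = 0.
  have : inner x (T x) = (inner x (T x))^*%R by rewrite -innerC sT.
  by rewrite conjCE; case: (inner _ _) => u v /= [] /eqP; rewrite eq_sym eqNr => /eqP.
have e : `|complex.Im (inner (y - mu *: x) (T x))| =
    `|complex.Im mu| * complex.Re (inner x (T x)).
  rewrite innerBl innerZl raddfB /= yr sub0r normrN.
  have := pT x; rewrite sT; move: xr; case: (inner x (T x)) => u v /= -> h.
  case: mu => m1 m2 /=; rewrite mulr0 add0r normrM; congr (_ * _).
  by rewrite ger0_norm// (le_trans _ h)// mulr_ge0 ?(ltW c0)// sqr_ge0.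
have := Im_le_nrm (inner (y - mu *: x) (T x)).
have := cauchy_schwarz (y - mu *: x) (T x); have := bT x; have := pT x.
rewrite e sT => h1 h2 h3 h4.
have h5 : `|complex.Im mu| * (c * nrm x ^+ 2) <=
    `|complex.Im mu| * complex.Re (inner x (T x)).
  by rewrite ler_wpM2l.
have h6 : nrm (y - mu *: x) * nrm (T x) <= nrm (y - mu *: x) * (b * nrm x).
  by rewrite ler_wpM2l ?nrm_ge0.
rewrite -(ler_pM2r xp); nra.
Qed.

(** A vector orthogonal to the closed range of [A - mu] is carried by [T'] to an eigenvector for the
    conjugate of [mu], which the bound at that number excludes. Used with [T = id] for [A0] and with
    [T = JC] for stable extensions. *)
Lemma selfadjoint_resolvent U (A : set (U * U)) (T T' : U -> U) (b c : R) :
  linear T -> (forall x, T (T' x) = x) ->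
  (forall x y, inner (T x) y = inner x (T y)) -> 0 <= b ->
  0 < c -> (forall x, nrm (T x) <= b * nrm x) ->
  (forall x, c * nrm x ^+ 2 <= complex.Re (inner (T x) x)) ->
  closed_relation A ->
  (forall x y, A (x, y) <-> forall p, A p -> inner p.2 (T x) = inner p.1 (T y)) ->
  forall mu : R[i], complex.Im mu != 0 -> resolvent_set A mu.
Proof.
move=> lT TT' sT b0 c0 bT pT Acl hA mu mu0.
have [_ _ _ TZ] := linear_funP lT.
have bnd (nu : R[i]) x y : complex.Im nu != 0 -> A (x, y) ->
    nrm x <= b / (c * `|complex.Im nu|) * nrm (y - nu *: x).
  move=> nu0 Axy; rewrite mulrAC ler_pdivlMr ?mulr_gt0 ?normr_gt0// mulrC.
  apply: (symmetric_im_bound sT b0 c0 bT pT) Axy => u v Auv.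
  exact: ((hA u v).1 Auv (u, v) Auv).
pose m := b / (c * `|complex.Im mu|).
have m0 : 0 <= m by rewrite divr_ge0// mulr_ge0// ltW.
have [rs rc] := closed_range Acl m0 (fun x y => @bnd mu x y mu0).
apply: (resolvent_set_intro Acl.1 m0 (fun x y => @bnd mu x y mu0)) => h.
apply: (closed_full rs rc) => w hw.
have z0 : A (T' w, mu^*%R *: T' w).
  apply/hA => -[x y] Axy /=; rewrite TZ TT' innerZr conjCK.
  apply/subr0_eq; rewrite -innerZl -innerBl innerC hw ?conjC0//.
  by exists x; rewrite subrK.
have cm : complex.Im mu^*%R != 0.
  by rewrite conjCE; case: mu mu0 {m m0 rs rc hw z0 bnd} => u v /=; rewrite oppr_eq0.
have := bnd _ _ _ cm z0; rewrite subrr nrm0 mulr0 => /(conj (nrm_ge0 _))/andP/le_anti.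
move=> /esym/nrm_eq0 T'0; rewrite -(TT' w) T'0.
by case: (linear_funP lT).
Qed.

Lemma commutesP U (A : set (U * U)) (C : U -> U) : C \o C = id ->
  commutes A C <-> forall x y, A (x, y) -> A (C x, C y).
Proof.
move=> CC; have CK x : C (C x) = x by rewrite -[LHS]/((C \o C) x) CC.
split=> [h x y Axy|h].
  have : (A \; graph C)%relation (C (C x), C y).
    by rewrite h; exists y => //; rewrite CK.
  by case=> z /graphE ->; rewrite CK.
apply/seteqP; split=> [[x y] [z /graphE/= -> Ay]|[x y] [z Az /graphE/= ->]].
  by exists (C y); rewrite /graph /= ?CK//; have := h _ _ Ay; rewrite CK.
by exists (C x) => //; exact: h.
Qed.

Lemma J_selfadjointP U (A : set (U * U)) (J : U -> U) : J \o J = id ->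
  (adjoint A \; graph J = graph J \; A)%relation <->
  forall x y, A (x, y) <-> adjoint A (J x, J y).
Proof.
move=> JJ; have JK x : J (J x) = x by rewrite -[LHS]/((J \o J) x) JJ.
split=> [h x y|h].
  have -> : A (x, y) <-> (graph J \; A)%relation (x, J y).
    split=> [Axy|[z Az /graphE/= e]]; first by exists y.
    by rewrite -(JK y) e JK.
  by rewrite -h; split=> [[z /graphE/= -> //]|Axy]; exists (J x).
apply/seteqP; split=> [[x y] [z /graphE/= -> Ay]|[x y] [z Az /graphE/= ->]].
  by exists (J y); rewrite /graph/= ?JK//; apply/h; rewrite JK.
by exists (J x) => //; exact/h.
Qed.

End Relations.

(** * Boundary triplets *)

Section Triplet.
Variables (R : realType) (H HH : hilbertType R) (S : set (H * H)) (G0 G1 : H -> HH).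
Hypotheses (S_closed : closed_operator S) (S_symmetric : symmetric_operator S)
  (triplet : boundary_triplet S G0 G1).
Let Sa := adjoint S.
Let A0 := A_0 S G0.

Lemma adjoint_submod : [/\ Sa (0, 0),
      forall x y x' y', Sa (x, y) -> Sa (x', y') -> Sa (x + x', y + y'),
      forall x y x' y', Sa (x, y) -> Sa (x', y') -> Sa (x - x', y - y')
    & forall a x y, Sa (x, y) -> Sa (a *: x, a *: y)].
Proof. exact: submod2P (adjoint_closed S).1. Qed.

Section BoundaryMaps.
Variable G : H -> HH.
Hypothesis G01 : G = G0 \/ G = G1.

Lemma boundary_lin a x x' y y' : Sa (x, x') -> Sa (y, y') ->
  G (a *: x + y) = a *: G x + G y.
Proof.
move=> Sx Sy; have [l0 l1 _ _] := triplet.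
by case: G01 => ->; [apply: l0 | apply: l1]; [exists x'|exists y'|exists x'|exists y'].
Qed.

Lemma boundaryD x x' y y' : Sa (x, x') -> Sa (y, y') -> G (x + y) = G x + G y.
Proof. by move=> Sx Sy; have := boundary_lin 1 Sx Sy; rewrite !scale1r. Qed.

Lemma boundary0 : G 0 = 0.
Proof.
have [S0 _ _ _] := adjoint_submod; have := boundary_lin 1 S0 S0.
by rewrite !scale1r addr0 => /eqP; rewrite addrC -subr_eq subrr eq_sym => /eqP.
Qed.

Lemma boundaryZ a x x' : Sa (x, x') -> G (a *: x) = a *: G x.
Proof.
have [S0 _ _ _] := adjoint_submod.
by move=> Sx; have := boundary_lin a Sx S0; rewrite boundary0 !addr0.
Qed.

Lemma boundaryB x x' y y' : Sa (x, x') -> Sa (y, y') -> G (x - y) = G x - G y.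
Proof.
move=> Sx Sy; have := boundary_lin (-1) Sy Sx.
by rewrite !scaleN1r addrC => ->; rewrite addrC.
Qed.

End BoundaryMaps.

Lemma isG0 : G0 = G0 \/ G0 = G1. Proof. by left. Qed.
Lemma isG1 : G1 = G0 \/ G1 = G1. Proof. by right. Qed.

Lemma green x x' y y' : Sa (x, x') -> Sa (y, y') ->
  inner x' y - inner x y' = inner (G1 x) (G0 y) - inner (G0 x) (G1 y).
Proof. by have [_ _ h _] := triplet; exact: h. Qed.

Lemma boundary_surj u v : exists f f', [/\ Sa (f, f'), G0 f = u & G1 f = v].
Proof.
have [_ _ _ h] := triplet.
have : [set (G0 f, G1 f) | f in reldom Sa] (u, v) by rewrite h.
by move=> [f [f' Sf] [<- <-]]; exists f, f'.
Qed.

(** Against an element of [S] the left side of Green's identity vanishes, and the right side is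
    tested on [f] with prescribed boundary values. *)
Lemma boundary_S x x' : S (x, x') -> [/\ Sa (x, x'), G0 x = 0 & G1 x = 0].
Proof.
move=> Sx; have Sax := S_symmetric Sx.
have h y y' : Sa (y, y') -> inner (G1 x) (G0 y) - inner (G0 x) (G1 y) = 0.
  by move=> Sy; rewrite -(green Sax Sy) -(Sy _ Sx) subrr.
split=> //; apply: inner_eq0.
  have [f [f' [Sf f0 f1]]] := boundary_surj 0 (G0 x).
  by have := h _ _ Sf; rewrite f0 f1 inner0r sub0r => /eqP; rewrite oppr_eq0 => /eqP.
have [f [f' [Sf f0 f1]]] := boundary_surj (G1 x) 0.
by have := h _ _ Sf; rewrite f0 f1 inner0r subr0.
Qed.

Lemma A0_selfadjoint x y :
  A0 (x, y) <-> forall p, A0 p -> inner p.2 x = inner p.1 y.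
Proof.
split=> [[/= Sx x0] [p p'] [/= Sp p0]|h].
  by apply/subr0_eq; rewrite (green Sp Sx) x0 p0 inner0l inner0r subrr.
have Sx : Sa (x, y).
  by move=> [p p'] Sp; apply: h; case: (boundary_S Sp) => ? ? _; split.
split=> //=; apply: inner_eq0; have [f [f' [Sf f0 f1]]] := boundary_surj 0 (G0 x).
have := green Sf Sx; rewrite (h (f, f')); last by split.
by rewrite subrr f0 inner0l subr0 f1.
Qed.

Lemma A0_adjoint : A0 = adjoint A0.
Proof.
by apply/seteqP; split=> [[x y] /A0_selfadjoint h|[x y] h]; [|apply/A0_selfadjoint].
Qed.

Lemma A0_closed : closed_relation A0.
Proof. by rewrite A0_adjoint; exact: adjoint_closed. Qed.

Lemma A0_resolvent (mu : R[i]) : complex.Im mu != 0 -> resolvent_set A0 mu.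
Proof.
apply: (@selfadjoint_resolvent _ _ _ id id 1 1) => //.
- by move=> x; rewrite mul1r.
- by move=> x; rewrite mul1r sqr_nrm.
- exact: A0_closed.
- exact: A0_selfadjoint.
Qed.

Lemma A0_im_bound (mu : R[i]) x y : A0 (x, y) ->
  `|complex.Im mu| * nrm x <= nrm (y - mu *: x).
Proof.
move=> Axy; rewrite -[leRHS]mul1r -[X in X * _]mul1r.
apply: (@symmetric_im_bound _ _ A0 id) => //.
- by move=> z; rewrite mul1r.
- by move=> z; rewrite mul1r sqr_nrm.
- by move=> u v Auv; exact: ((A0_selfadjoint u v).1 Auv (u, v) Auv).
Qed.

Lemma A0_resolvent_conj (mu : R[i]) :
  resolvent_set A0 mu -> resolvent_set A0 mu^*%R.
Proof.
move=> rmu; have [i0|i0] := eqVneq (complex.Im mu) 0.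
  by rewrite conjCE; case: mu i0 rmu => a b /= ->; rewrite oppr0.
by apply: A0_resolvent; rewrite conjCE; case: mu i0 {rmu} => a b /=; rewrite oppr_eq0.
Qed.

Lemma A0_solve mu : resolvent_set A0 mu -> forall h, exists x, A0 (x, h + mu *: x).
Proof.
move=> [B _ rB] h; exists (B h); apply/resolventE; rewrite rB.
by apply/graphE.
Qed.

Lemma A0_unique mu x y h : resolvent_set A0 mu ->
  A0 (x, h + mu *: x) -> A0 (y, h + mu *: y) -> x = y.
Proof.
move=> [B _ rB] /(resolvent_graph rB) + /(resolvent_graph rB).
by rewrite !addrK => -> ->.
Qed.

(** Any [x] with [G0 x = u] is corrected by the solution in [A0] of the same inhomogeneous equation.
    With [defect_unique], the gamma field is a bijection of [HH] onto the defect space. *)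
Lemma defect_solve mu u : resolvent_set A0 mu ->
  exists2 f, defect_space S mu f & G0 f = u.
Proof.
have [S0 SD SB SZ] := adjoint_submod.
move=> rmu; have [x [x' [Sx x0 _]]] := boundary_surj u 0.
have [y [/= Sy y0]] := A0_solve rmu (x' - mu *: x).
exists (x - y).
  have := SB _ _ _ _ Sx Sy; rewrite /defect_space /=.
  by congr (Sa (_, _)); rewrite scalerBr opprD opprB addrA [x' + _]addrCA subrr addr0.
by rewrite (boundaryB isG0 Sx Sy) y0 subr0.
Qed.

Lemma defect_unique mu f g : resolvent_set A0 mu -> defect_space S mu f ->
  defect_space S mu g -> G0 f = G0 g -> f = g.
Proof.
have [S0 SD SB SZ] := adjoint_submod.
move=> rmu Nf Ng fg; apply/subr0_eq; apply: (A0_unique (h := 0) rmu).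
  split=> /=; last by rewrite (boundaryB isG0 Nf Ng) fg subrr.
  by rewrite add0r scalerBr; exact: SB Nf Ng.
rewrite scaler0 addr0; split=> //=; exact: boundary0 isG0.
Qed.

(** The identity [gamma(conj mu)^* = G1 (A0 - mu)^-1]; the other boundary term of Green's identity
    drops out since [G0 y = 0]. *)
Lemma adjoint_gammaP mu h g : resolvent_set A0 mu ->
  adjoint (gamma_field S G0 mu^*%R) (h, g) <->
  exists2 y, A0 (y, h + mu *: y) & g = G1 y.
Proof.
move=> rmu.
have key f y : defect_space S mu^*%R f -> A0 (y, h + mu *: y) ->
    inner f h = inner (G0 f) (G1 y).
  move=> Nf [/= Sy y0]; have := green Nf Sy.
  rewrite y0 inner0r sub0r innerZl innerDr innerZr => e.
  by apply: oppr_inj; rewrite -e; ring.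
split=> [hg|[y Ay ->] _ [f Nf <-] /=]; last exact: key.
have [y Ay] := A0_solve rmu h; exists y => //.
apply: inner_injr => z.
have [f Nf <-] := defect_solve z (A0_resolvent_conj rmu).
by rewrite -(key f y Nf Ay); apply/esym; exact: (hg (G0 f, f) (imageP _ Nf)).
Qed.

Definition extension_of (K : set (HH * HH)) : set (H * H) :=
  [set p | Sa p /\ K (G0 p.1, G1 p.1)].

(** An identity of relations, even when [mu] is outside the resolvent set of the extension. A
    solution is [z = y - f] with [y] the solution for [A0] and [f] in the defect space; its boundary
    condition reads [(- G0 f, G1 y - G1 f)] in [K]. *)
Lemma krein_resolvent (K : set (HH * HH)) mu : submod_closed (mem K) ->
  resolvent_set A0 mu ->
  rel_sub (resolvent A0 mu)
    (gamma_field S G0 mu \;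
      ((rel_sub (weyl_function S G0 G1 mu) K)^-1 \;
        adjoint (gamma_field S G0 mu^*%R)))%relation
  = resolvent (extension_of K) mu.
Proof.
move=> /submod2P[K0 KD KB KZ] rmu.
have [S0 SD SB SZ] := adjoint_submod.
apply/seteqP; split=> [[h z] [y [w [/= /resolventE Ay]]]|[h z] /resolventE[/= Sz Kz]].
  move=> [u [g /= /(adjoint_gammaP _ _ rmu)[y' Ay' ->]]].
  rewrite -(A0_unique rmu Ay Ay') => -[a [b [/= [f Nf [f0 <-]] Kub Gab]]].
  move=> [f' Nf' [f'0 <-]] ->.
  have ff' : f = f' by apply: (defect_unique rmu Nf Nf'); rewrite f0 f'0.
  rewrite -ff' {f' ff' Nf' f'0}.
  have [/= Sy y0] := Ay.
  apply/resolventE; split=> /=.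
    rewrite scalerBr addrA; exact: SB Sy Nf.
  rewrite (boundaryB isG0 Sy Nf) (boundaryB isG1 Sy Nf) y0 f0 Gab.
  by rewrite addrAC subrr !add0r; have := KZ (-1) _ _ Kub; rewrite !scaleN1r; exact.
have [y Ay] := A0_solve rmu h; have [/= Sy y0] := Ay.
have Nf : defect_space S mu (y - z).
  have := SB _ _ _ _ Sy Sz; rewrite /defect_space /=.
  by congr (Sa (_, _)); rewrite scalerBr opprD addrACA subrr add0r.
exists y, (y - z); split=> /=; last by rewrite opprB addrC subrK.
  exact/resolventE.
exists (G0 (y - z)); last by exists (y - z).
exists (G1 y); first by apply/(adjoint_gammaP _ _ rmu); exists y.
exists (G1 (y - z)), (- G1 z); split=> /=.
- by exists (y - z).
- rewrite (boundaryB isG0 Sy Sz) y0 sub0r.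
  by have := KZ (-1) _ _ Kz; rewrite !scaleN1r.
- by rewrite opprK (boundaryB isG1 Sy Sz) subrK.
Qed.

Lemma resolvent_inj (A B : set (H * H)) mu :
  resolvent A mu = resolvent B mu -> A = B.
Proof.
move=> e; apply/seteqP; split=> [[x y]|[x y]] h.
  have : resolvent A mu (y - mu *: x, x) by apply/resolventE; rewrite subrK.
  by rewrite e => /resolventE; rewrite subrK.
have : resolvent B mu (y - mu *: x, x) by apply/resolventE; rewrite subrK.
by rewrite -e => /resolventE; rewrite subrK.
Qed.

(* [x' - i x] is orthogonal to the defect space of [-i], so it lies in the closed range
   of [S - i]; the preimage is [x] because [A_0 - i] is injective. *)
Lemma S_boundary x x' : Sa (x, x') -> G0 x = 0 -> G1 x = 0 -> S (x, x').
Proof.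
move=> Sx x0 x1.
have I0 : complex.Im ('i%C : R[i]) != 0 by rewrite /= oner_neq0.
have S2A p p' : S (p, p') -> A0 (p, p') by case/boundary_S => ? ? _; split.
have bnd u v : S (u, v) -> nrm u <= 1 * nrm (v - 'i%C *: u).
  by move=> /S2A/(A0_im_bound 'i%C); rewrite /= normr1 !mul1r.
have [rs rc] := closed_range S_closed.1 ler01 bnd.
have [w [z Sz] hw] := ortho_projection rs rc (x' - 'i%C *: x).
set p := x' - 'i%C *: x - w in hw.
have Np : Sa (p, (- 'i%C) *: p).
  move=> [u v] Suv /=; have : inner (v - 'i%C *: u) p = 0.
    by rewrite innerC hw ?conjC0//; exists u; rewrite subrK.
  rewrite innerBl innerZl => /subr0_eq ->; rewrite innerZr conjCE; congr (_ * _).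
  by apply/eqP; rewrite eq_complex /= oppr0 opprK !eqxx.
have wp : inner (x' - 'i%C *: x) p = 0.
  have := green Sx Np; rewrite x0 x1 !inner0l subrr innerBl innerZl innerZr => <-.
  congr (_ - _ * _); rewrite conjCE; apply/eqP.
  by rewrite eq_complex /= oppr0 opprK !eqxx.
have p0 : p = 0.
  apply: inner_eq0; rewrite {1}/p innerBl wp sub0r innerC hw ?conjC0 ?oppr0//.
  by exists z.
have wE : w = x' - 'i%C *: x by rewrite (subr0_eq p0).
have Ax : A0 (x, w + 'i%C *: x) by rewrite wE subrK; split.
have xz := A0_unique (A0_resolvent I0) Ax (S2A _ _ Sz).
by move: Sz; rewrite -xz wE subrK.
Qed.

End Triplet.

(** * Symmetric and positive operators *)

Section Operators.
Variable R : realType.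
Implicit Types U V : hilbertType R.

Lemma selfadjointP U (T : U -> U) :
  adjoint (graph T) = graph T <-> forall x y, inner (T x) y = inner x (T y).
Proof.
split=> [h x y|h].
  have : adjoint (graph T) (y, T y) by rewrite h.
  by move=> /(_ (x, T x) erefl).
apply/seteqP; split=> [[x y] hxy|[x y] /graphE -> [p p'] /graphE -> //=].
apply/graphE/inner_injr => z.
by rewrite -h; apply/esym/(hxy (z, T z)).
Qed.

Lemma symmetric_real U (T : U -> U) x : (forall x y, inner (T x) y = inner x (T y)) ->
  complex.Im (inner (T x) x) = 0.
Proof.
move=> sT; have : inner (T x) x = (inner (T x) x)^*%R by rewrite -innerC sT.
by rewrite conjCE; case: (inner _ _) => u v /= [] /eqP; rewrite eq_sym eqNr => /eqP.
Qed.

(** By [positive_form_bound], [<T x, x> = 0] forces [T x = 0]; this turns injectivity into strict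
    positivity. *)
Lemma positive_operatorI U (T : U -> U) (b : R) : linear T -> 0 <= b ->
  (forall x, nrm (T x) <= b * nrm x) ->
  (forall x y, inner (T x) y = inner x (T y)) ->
  (forall x, 0 <= complex.Re (inner (T x) x)) ->
  (forall x, T x = 0 -> x = 0) -> positive_operator T.
Proof.
move=> lT b0 bT sT pT iT; split.
  by split; [apply/bounded_operatorP; split=> //; exists b|apply/selfadjointP].
move=> x x0; have := positive_form_bound b0 lT sT pT bT x.
have := pT x; have := symmetric_real x sT; rewrite ltcE.
case: (inner (T x) x) => u v /= -> u0 Tu; rewrite eqxx /= lt_def u0 andbT.
apply: contra_neq x0 => uz; apply: iT; apply/nrm_eq0/eqP; rewrite -sqrf_eq0.
by apply/eqP/le_anti; rewrite sqr_ge0 andbT; move: Tu; rewrite uz mulr0.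
Qed.

Lemma positive_operatorE U (T : U -> U) : positive_operator T ->
  [/\ linear T, forall x y, inner (T x) y = inner x (T y),
      forall x, 0 <= complex.Re (inner (T x) x)
    & exists2 b : R, 0 <= b & forall x, nrm (T x) <= b * nrm x].
Proof.
move=> [[/bounded_operatorP[lT bT] /selfadjointP sT] pT]; split=> // x.
have [->|x0] := eqVneq x 0; first by rewrite inner0r.
by have /ltW := pT x x0; rewrite lecE => /andP[].
Qed.

(** [|x|^2 <= m^2 |T x|^2 <= m^2 b <T x, x>]; the added 1 keeps the constant invertible. *)
Lemma positive_coercive U (T T' : U -> U) (m : R) : positive_operator T ->
  (forall x, T' (T x) = x) -> (forall x, nrm (T' x) <= m * nrm x) ->
  exists2 c : R, 0 < c & forall x, c * nrm x ^+ 2 <= complex.Re (inner (T x) x).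
Proof.
move=> /positive_operatorE[lT sT pT [b b0 bT]] TT' mT'.
have d0 : 0 < m ^+ 2 * b + 1 by rewrite ltr_wpDl// mulr_ge0// sqr_ge0.
exists (m ^+ 2 * b + 1)^-1; first by rewrite invr_gt0.
move=> x; rewrite mulrC ler_pdivrMr//.
have h1 := positive_form_bound b0 lT sT pT bT x.
have h2 : nrm x ^+ 2 <= m ^+ 2 * nrm (T x) ^+ 2.
  have := mT' (T x); rewrite TT' -exprMn => h.
  by rewrite lerXn2r ?nnegrE ?nrm_ge0// (le_trans (nrm_ge0 _) h).
have h3 : m ^+ 2 * nrm (T x) ^+ 2 <= m ^+ 2 * (b * complex.Re (inner (T x) x)).
  by rewrite ler_wpM2l ?sqr_ge0.
have := pT x; lra.
Qed.

Lemma involution_nrm U (J : U -> U) : J \o J = id ->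
  (forall x y, inner (J x) y = inner x (J y)) -> forall x, nrm (J x) = nrm x.
Proof.
move=> JJ sJ x; apply/eqP; rewrite -(@eqrXn2 _ 2)// ?nrm_ge0// !sqr_nrm sJ.
by rewrite -[J (J x)]/((J \o J) x) JJ.
Qed.

End Operators.

(** * Operators intertwined by the boundary maps *)

Section Transfer.
Variables (R : realType) (H HH : hilbertType R) (S : set (H * H)) (G0 G1 : H -> HH).
Hypotheses (S_closed : closed_operator S) (S_symmetric : symmetric_operator S)
  (triplet : boundary_triplet S G0 G1).
Let Sa := adjoint S.
Let A0 := A_0 S G0.

(** Invariance of [Sa] is included because the boundary maps carry no information outside its
    domain. *)
Definition intertwines (T : H -> H) (t : HH -> HH) :=
  forall x x', Sa (x, x') -> 
    [/\ Sa (T x, T x'), t (G0 x) = G0 (T x) & t (G1 x) = G1 (T x)].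

Lemma adjoint_commutes (T T' : H -> H) :
  (forall x y, inner (T x) y = inner x (T' y)) ->
  (forall x y, S (x, y) -> S (T x, T y)) ->
  forall x y, Sa (x, y) -> Sa (T' x, T' y).
Proof.
by move=> TT' ST x y Sx [p p'] Sp; have := Sx _ (ST _ _ Sp); rewrite /= !TT'.
Qed.

(** With [G0 x = 0] and [G1 y = 0] a single boundary term of Green's identity survives, and it is
    the required inner product; any [u] and [v] occur as the remaining boundary values. *)
Lemma intertwines_adjoint T T' t t' : t 0 = 0 -> t' 0 = 0 ->
  (forall x y, inner (T x) y = inner x (T' y)) ->
  intertwines T t -> intertwines T' t' ->
  forall u v, inner (t u) v = inner u (t' v).
Proof.
move=> t0 t'0 TT' Tt T't' u v.
have [x [x' [Sx x0 <-]]] := boundary_surj triplet 0 u.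
have [y [y' [Sy <- y1]]] := boundary_surj triplet v 0.
have [STx t0x t1x] := Tt _ _ Sx; have [STy t0y t1y] := T't' _ _ Sy.
have := green triplet STx Sy; have := green triplet Sx STy.
rewrite -!TT' -t0x -t1x -t0y -t1y x0 y1 t0 t'0 !inner0l !subr0 => -> ->.
by [].
Qed.

(* For [d u_n = u_(n+1)] with [u_0 = G0 f], Green's formula against [y] with
   [G0 y = 0] and [G1 y = u_0] expresses [<d^n u_0, u_0>] through [D^n f] and [D^n f']. *)
Lemma intertwines_bound D d (c : R) : 0 <= c -> intertwines D d ->
  (forall u v, inner (d u) v = inner u (d v)) ->
  (forall x, nrm (D x) <= c * nrm x) -> forall u, nrm (d u) <= c * nrm u.
Proof.
move=> c0 Dd sd bD u.
have [f [f' [Sf f0 _]]] := boundary_surj triplet u 0.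
have [y [y' [Sy y0 y1]]] := boundary_surj triplet 0 u.
have it n : Sa (iter n D f, iter n D f') /\ G0 (iter n D f) = iter n d u.
  elim: n => [//|n [IH1 IH2]] /=; have [h1 h2 _] := Dd _ _ IH1.
  by split=> //; rewrite -IH2.
have bit n z : nrm (iter n D z) <= c ^+ n * nrm z.
  elim: n => [|n IH]; first by rewrite expr0 mul1r.
  by rewrite exprS -mulrA /=; apply: le_trans (bD _) _; rewrite ler_wpM2l.
pose K := nrm f' * nrm y + nrm f * nrm y'.
apply: (@hankel_growth _ _ (fun n => iter n d u) c K) => //=.
move=> n; have [Sn Gn] := it n.
have := green triplet Sn Sy; rewrite y0 y1 inner0r sub0r Gn => /(congr1 (@nrm R _)).
rewrite nrmN => <-; apply: le_trans (nrmB _ _) _.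
have := cauchy_schwarz (iter n D f') y; have := cauchy_schwarz (iter n D f) y'.
rewrite /K; have h1 : nrm (iter n D f') * nrm y <= c ^+ n * nrm f' * nrm y.
  by rewrite ler_wpM2r ?nrm_ge0.
have h2 : nrm (iter n D f) * nrm y' <= c ^+ n * nrm f * nrm y'.
  by rewrite ler_wpM2r ?nrm_ge0.
lra.
Qed.

Lemma intertwines_comp T1 t1 T2 t2 : intertwines T1 t1 -> intertwines T2 t2 ->
  intertwines (T1 \o T2) (t1 \o t2).
Proof.
move=> h1 h2 x x' Sx; have [S2 g20 g21] := h2 _ _ Sx.
have [S1 g10 g11] := h1 _ _ S2.
by split=> //=; rewrite ?g20 ?g21.
Qed.

Lemma intertwines_shift (b : R[i]) T t : intertwines T t ->
  intertwines (fun x => b *: x - T x) (fun u => b *: u - t u).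
Proof.
move=> h x x' Sx; have [ST g0 g1] := h _ _ Sx.
have [_ _ SB SZ] := adjoint_submod S.
have SbX := SZ b _ _ Sx.
split; first exact: SB.
  by rewrite (boundaryB triplet (isG0 _ _) SbX ST) (boundaryZ triplet (isG0 _ _) _ Sx) g0.
by rewrite (boundaryB triplet (isG1 _ _) SbX ST) (boundaryZ triplet (isG1 _ _) _ Sx) g1.
Qed.

Lemma intertwines_involution T t : intertwines T t -> T \o T = id -> t \o t = id.
Proof.
move=> h TT; apply/funext => u /=.
have [f [f' [Sf <- _]]] := boundary_surj triplet u 0.
have [S1 g0 _] := h _ _ Sf; have [_ g0' _] := h _ _ S1.
by rewrite g0 g0' -[T (T f)]/((T \o T) f) TT.
Qed.

(* Positivity of [T] is equivalent to [|b x - T x| <= b |x|] for large [b], and bounds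
   of this kind pass to the boundary space. *)
Lemma intertwines_positive T t : linear t -> intertwines T t ->
  positive_operator T -> (forall u, t u = 0 -> u = 0) -> positive_operator t.
Proof.
move=> lt Tt /positive_operatorE[lT sT pT [b b0 bT]] it.
have [t0 tD _ _] := linear_funP lt.
have st : forall u v, inner (t u) v = inner u (t v).
  exact: (intertwines_adjoint t0 t0 sT Tt Tt).
have sh u : nrm (b%:C *: u - t u) <= b * nrm u.
  apply: (intertwines_bound b0 (intertwines_shift b%:C Tt)).
    by move=> v w; rewrite innerBl innerBr innerZl innerZr conjR st.
  exact: positive_form_shift.
apply: (@positive_operatorI _ _ _ (b + b)) => //; first exact: addr_ge0.
  move=> u; rewrite -[t u](subKr (b%:C *: u)); apply: le_trans (nrmB _ _) _.
  by rewrite mulrDl lerD// nrmZ nrmC ger0_norm.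
by move=> u; apply: form_of_shift b0 (sh u).
Qed.

End Transfer.

(** * C-symmetries *)

Section Symmetries.
Variables (R : realType) (H HH : hilbertType R) (S : set (H * H)) (G0 G1 : H -> HH).
Hypotheses (S_closed : closed_operator S) (S_symmetric : symmetric_operator S)
  (triplet : boundary_triplet S G0 G1).
Variables (J : H -> H) (cJ : HH -> HH).
Hypotheses (J_symmetry : fundamental_symmetry J) (SJ : commutes S J)
  (J_image : boundary_image S G0 G1 J cJ).
Let Sa := adjoint S.
Let A0 := A_0 S G0.

Lemma J_symm x y : inner (J x) y = inner x (J y).
Proof. by case: J_symmetry => -[_ /selfadjointP]. Qed.

Lemma J_invol x : J (J x) = x.
Proof. by case: J_symmetry => _ JJ; rewrite -[LHS]/((J \o J) x) JJ. Qed.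

Lemma J_S x y : S (x, y) -> S (J x, J y).
Proof. by case: J_symmetry => _ JJ; move: x y; apply/commutesP. Qed.

Lemma image_intertwines C cC : boundary_image S G0 G1 C cC ->
  (forall x y, Sa (x, y) -> Sa (C x, C y)) -> intertwines S G0 G1 C cC.
Proof.
move=> [_ h] hC x x' Sx; have [|h0 h1] := h x; first by exists x'.
by split=> //; exact: hC.
Qed.

Lemma J_intertwines : intertwines S G0 G1 J cJ.
Proof. exact: image_intertwines (adjoint_commutes J_symm J_S). Qed.

Lemma cJ_lin : linear cJ. Proof. by case: J_image. Qed.

Lemma cJ_symm u v : inner (cJ u) v = inner u (cJ v).
Proof.
have [c0 _ _ _] := linear_funP cJ_lin.
exact: (intertwines_adjoint triplet c0 c0 J_symm J_intertwines J_intertwines).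
Qed.

Lemma cJ_inv : cJ \o cJ = id.
Proof. by apply: (intertwines_involution triplet J_intertwines); case: J_symmetry. Qed.

Lemma cJ_invol u : cJ (cJ u) = u.
Proof. by rewrite -[LHS]/((cJ \o cJ) u) cJ_inv. Qed.

Lemma cJ_nrm u : nrm (cJ u) = nrm u.
Proof. exact: involution_nrm cJ_inv cJ_symm u. Qed.

Section Csym.
Variable C : H -> H.
Hypothesis C_sym : C_symmetry_of S J C.

Lemma C_invol x : C (C x) = x.
Proof. by case: C_sym => _ CC _ _; rewrite -[LHS]/((C \o C) x) CC. Qed.

Lemma C_S x y : S (x, y) -> S (C x, C y).
Proof. by case: C_sym => _ CC _ h; move: x y; apply/commutesP. Qed.

(** Self-adjointness of [JC] makes [JCJ] the adjoint of [C]. Since [JCJ] preserves [S], [C] itself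
    preserves the adjoint of [S]. *)
Lemma C_adjoint x y : inner (J (C (J x))) y = inner x (C y).
Proof.
case: C_sym => _ _ /positive_operatorE[_ sT _ _] _.
by rewrite [LHS](sT (J x) y) /= J_symm J_invol.
Qed.

Lemma C_Sa x y : Sa (x, y) -> Sa (C x, C y).
Proof.
move: x y; apply: adjoint_commutes C_adjoint _ => x y Sx.
exact/J_S/C_S/J_S.
Qed.

Variable cC : HH -> HH.
Hypothesis C_image : boundary_image S G0 G1 C cC.

Lemma C_intertwines : intertwines S G0 G1 C cC.
Proof. exact: image_intertwines C_Sa. Qed.

Lemma cC_involution : cC \o cC = id.
Proof. by apply: (intertwines_involution triplet C_intertwines); case: C_sym. Qed.

Lemma cC_invol u : cC (cC u) = u.
Proof. by rewrite -[LHS]/((cC \o cC) u) cC_involution. Qed.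

Lemma cJcC_positive : positive_operator (cJ \o cC).
Proof.
apply: (@intertwines_positive _ _ _ S G0 G1 triplet (J \o C)).
- move=> a u v /=; rewrite C_image.1 cJ_lin //.
- exact: intertwines_comp J_intertwines C_intertwines.
- by case: C_sym.
- move=> u /= u0; rewrite -(cC_invol u) -(cJ_invol (cC u)) u0.
  have [-> _ _ _] := linear_funP cJ_lin.
  by have [-> _ _ _] := linear_funP C_image.1.
Qed.

Lemma cC_bounded : bounded_operator cC.
Proof.
apply/bounded_operatorP; split; first exact: C_image.1.
have [_ _ _ [b b0 bT]] := positive_operatorE cJcC_positive.
by exists b => // u; rewrite -cJ_nrm; exact: bT.
Qed.

Lemma cC_weyl : commutes_weyl S G0 G1 cC.
Proof.
move=> l _; apply/(commutesP _ cC_involution) => u v [f Nf [<- <-]].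
have [Sf -> ->] := C_intertwines Nf.
exists (C f) => //; rewrite /defect_space /=.
have [[/linear_funP[_ _ _ CZ] _] _ _ _] := C_sym.
by rewrite -CZ.
Qed.

End Csym.

(** * Extensions and their boundary parameters *)

Section Extension.
Variable K : set (HH * HH).
Hypothesis K_sub : submod_closed (mem K).
Let A := extension_of S G0 G1 K.

Lemma extension_S : S `<=` A.
Proof.
move=> [x y] /(boundary_S S_symmetric triplet)[Sx x0 x1].
by split=> //=; rewrite x0 x1; case: (submod2P K_sub).
Qed.

Lemma extension_submod : submod_closed (mem A).
Proof.
have [K0 KD _ KZ] := submod2P K_sub; have [S0 SD _ SZ] := adjoint_submod S.
apply: submodI.
  split=> //=.
  by rewrite (boundary0 triplet (isG0 _ _)) (boundary0 triplet (isG1 _ _)).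
move=> a [x x'] [y y'] [/= Sx Kx] [/= Sy Ky]; split=> /=.
  exact: SD (SZ a _ _ Sx) Sy.
rewrite (boundary_lin triplet (isG0 _ _) a Sx Sy).
rewrite (boundary_lin triplet (isG1 _ _) a Sx Sy).
exact: KD (KZ a _ _ Kx) Ky.
Qed.

(** Green's identity reduces membership in the adjoint of [A] to boundary values, and every pair of
    [K] is the boundary value of an element of [A]. *)
Lemma extension_adjoint x x' : Sa (x, x') ->
  adjoint A (J x, J x') <->
  forall f, K f -> inner (cJ f.2) (G0 x) = inner (cJ f.1) (G1 x).
Proof.
move=> Sx; have [SJx J0 J1] := J_intertwines Sx.
have key f f' : Sa (f, f') -> inner f' (J x) - inner f (J x') =
    inner (cJ (G1 f)) (G0 x) - inner (cJ (G0 f)) (G1 x).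
  by move=> Sf; rewrite (green triplet Sf SJx) !cJ_symm J0 J1.
split=> [h [u v] Kuv|h [f f'] [/= Sf Kf]].
  have [f [f' [Sf f0 f1]]] := boundary_surj triplet u v.
  have Af : A (f, f') by split=> //=; rewrite f0 f1.
  apply/subr0_eq; rewrite /= -f0 -f1 -(key _ _ Sf).
  by rewrite (h _ Af) subrr.
by apply/subr0_eq; rewrite (key _ _ Sf) (h _ Kf) subrr.
Qed.

(** The [cJ]-adjoint of [K]; a [cJ]-self-adjoint relation is a fixed point. *)
Definition J_orthogonal := [set g : HH * HH | forall f, K f ->
  inner (cJ f.2) g.1 = inner (cJ f.1) g.2].

Lemma extension_J_selfadjoint :
  (forall x y, A (x, y) <-> adjoint A (J x, J y)) <-> K = J_orthogonal.
Proof.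
split=> [h|h x y].
  have kk u v : K (u, v) <-> J_orthogonal (u, v).
    have [f [f' [Sf <- <-]]] := boundary_surj triplet u v.
    apply: (iff_trans _ (extension_adjoint Sf)); apply: (iff_trans _ (h f f')).
    by split=> [Kf|[]].
  by apply/seteqP; split=> [[u v] /kk|[u v] /kk].
split=> [[/= Sx Kx]|hx]; first by apply/(extension_adjoint Sx); rewrite h in Kx.
have Sx : Sa (x, y).
  rewrite -(J_invol x) -(J_invol y).
  suff /J_intertwines[] : Sa (J x, J y) by [].
  by move=> p /extension_S; exact: hx.
by split=> //=; rewrite h; exact/(extension_adjoint Sx).
Qed.

Lemma extension_commutes C cC : intertwines S G0 G1 C cC -> cC \o cC = id ->
  (forall x y, A (x, y) -> A (C x, C y)) <->
  K = [set (cC f.1, cC f.2) | f in K].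
Proof.
move=> Cc cc; have ccK u : cC (cC u) = u by rewrite -[LHS]/((cC \o cC) u) cc.
split=> [h|h x y [/= Sx Kx]]; last first.
  have [SCx C0 C1] := Cc _ _ Sx; split=> //=.
  by rewrite -C0 -C1 h; exists (G0 x, G1 x).
have Kc u v : K (u, v) -> K (cC u, cC v).
  have [f [f' [Sf <- <-]]] := boundary_surj triplet u v => Kf.
  have [_ -> ->] := Cc _ _ Sf.
  by have [] := h f f' (conj Sf Kf).
apply/seteqP; split=> [[u v] Kuv|_ [[u v] Kuv <-]]; last exact: Kc.
by exists (cC u, cC v); [exact: Kc|rewrite /= !ccK].
Qed.

End Extension.

(** The parameter of a [J]-self-adjoint extension is closed because it is a [cJ]-adjoint. *)
Lemma J_orthogonal_closed K : closed_relation (J_orthogonal K).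
Proof.
have -> : J_orthogonal K = adjoint [set (cJ f.1, cJ f.2) | f in K].
  apply/seteqP; split=> [g h _ [f Kf <-]|g h f Kf] /=; first exact: h.
  exact: (h (cJ f.1, cJ f.2) (imageP _ Kf)).
exact: adjoint_closed.
Qed.

(** [K] consists of all boundary values of [A]. Elements with equal boundary values differ by an
    element of [S], so [K] determines [A]. *)
Lemma boundary_parameter (A : set (H * H)) : submod_closed (mem A) ->
  S `<=` A -> A `<=` Sa -> exists2 K, submod_closed (mem K) & A = extension_of S G0 G1 K.
Proof.
move=> As SA ASa; have [A00 AD AB AZ] := submod2P As.
exists [set (G0 f, G1 f) | f in reldom A].
  apply: submodI.
    exists 0; first by exists 0.
    by rewrite (boundary0 triplet (isG0 _ _)) (boundary0 triplet (isG1 _ _)).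
  move=> a _ _ [f [f' Af] <-] [g [g' Ag] <-].
  exists (a *: f + g); first by exists (a *: f' + g'); exact: AD (AZ a _ _ Af) Ag.
  have Sf := ASa _ Af; have Sg := ASa _ Ag.
  rewrite (boundary_lin triplet (isG0 _ _) a Sf Sg).
  by rewrite (boundary_lin triplet (isG1 _ _) a Sf Sg).
apply/seteqP; split=> [[x y] Ax|[x y] [/= Sx [f [f' Af] [f0 f1]]]].
  by split; [exact: ASa|exists x => //; exists y].
have Sf := ASa _ Af; have [_ _ SB _] := adjoint_submod S.
have Sxf := SB _ _ _ _ Sx Sf.
have : S (x - f, y - f').
  apply: (S_boundary S_closed S_symmetric triplet Sxf).
    by rewrite (boundaryB triplet (isG0 _ _) Sx Sf) f0 subrr.
  by rewrite (boundaryB triplet (isG1 _ _) Sx Sf) f1 subrr.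
by move=> /SA /(AD _ _ _ _ Af); rewrite ![_ + (_ - _)]addrC !subrK.
Qed.

Lemma symmetric_extension_resolvent (A : set (H * H)) C : closed_relation A ->
  C_symmetry_of S J C -> (forall x y, A (x, y) <-> adjoint A (J x, J y)) ->
  (forall x y, A (x, y) -> A (C x, C y)) ->
  forall mu : R[i], complex.Im mu != 0 -> resolvent_set A mu.
Proof.
move=> Acl C_sym AJ AC.
have [/bounded_operatorP[lC [m m0 hm]] _ pT _] := C_sym.
have [lT sT posT [b b0 bT]] := positive_operatorE pT.
have [c c0 hc] : exists2 c : R, 0 < c &
    forall x, c * nrm x ^+ 2 <= complex.Re (inner ((J \o C) x) x).
  apply: (@positive_coercive _ _ _ (C \o J) m) => // x /=.
    by rewrite J_invol (C_invol C_sym).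
  apply: le_trans (hm _) _; rewrite (involution_nrm _ J_symm)//.
  by case: J_symmetry.
apply: (selfadjoint_resolvent (T := J \o C) (T' := C \o J) lT _ sT b0 c0 bT hc Acl).
  by move=> x /=; rewrite (C_invol C_sym) J_invol.
(* Invariance under [C] inserts [C] into the [J]-self-adjointness condition, which becomes
   self-adjointness for [<JC x, y>]. *)
move=> x y; rewrite [X in X <-> _](_ : _ <-> adjoint A (J (C x), J (C y))).
  by [].
rewrite -AJ; split=> [|/AC]; first exact: AC.
by rewrite !(C_invol C_sym).
Qed.

End Symmetries.

(** * The gamma field *)

Section More.
Variables (R : realType) (H : hilbertType R).

Lemma closure_submod (D : set H) : submod_closed (mem D) ->
  submod_closed (mem (closure D)).
Proof.
move=> /submodP[D0 DD _ DZ]; apply: submodI.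
  by apply/closureP => e e0; exists 0; rewrite ?subrr ?nrm0.
move=> a x y /closureP Dx /closureP Dy; apply/closureP => e e0.
have p : 0 < nrm a + 1 by rewrite ltr_wpDl ?nrm_ge0.
have [x' Dx' xx] := Dx _ (divr_gt0 (divr_gt0 e0 (ltr0Sn R 1)) p).
have [y' Dy' yy] := Dy _ (divr_gt0 e0 (ltr0Sn R 1)).
exists (a *: x' + y'); first exact: DD (DZ a _ Dx') Dy'.
rewrite [X in nrm X](_ : _ = a *: (x - x') + (y - y')); last first.
  by rewrite scalerBr opprD addrACA.
apply: le_lt_trans (nrmD _ _) _; rewrite nrmZ.
move: xx; rewrite ltr_pdivlMr// => xx.
have := nrm_ge0 a; have := nrm_ge0 (x - x'); lra.
Qed.

Lemma closed_perp (x : H) : closed [set f | inner f x = 0].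
Proof.
move=> f /closureP fx; apply: (@nrm_small _ _ _ (nrm x)) => e e0.
have [g gx fg] := fx e e0.
rewrite -[inner f x]subr0 -gx -innerBl; apply: le_trans (cauchy_schwarz _ _) _.
by rewrite ler_wpM2r ?nrm_ge0// ltW.
Qed.

Lemma closed_equalizer (T1 T2 : H -> H) (m : R) : 0 <= m -> linear T1 -> linear T2 ->
  (forall x, nrm (T1 x) <= m * nrm x) -> (forall x, nrm (T2 x) <= m * nrm x) ->
  submod_closed (mem [set x | T1 x = T2 x]) /\ closed [set x | T1 x = T2 x].
Proof.
move=> m0 l1 l2 b1 b2; have [z1 _ B1 _] := linear_funP l1.
have [z2 _ B2 _] := linear_funP l2; split.
  apply: submodI => [|a x y /= ex ey]; first by rewrite /= z1 z2.
  by rewrite l1 l2 ex ey.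
move=> x /closureP cx; apply/subr0_eq.
apply: (@nrm_small _ _ _ (m + m)) => e e0; have [y /= ey xy] := cx e e0.
have -> : T1 x - T2 x = T1 (x - y) - T2 (x - y).
  by rewrite B1 B2 ey opprB addrA subrK.
apply: le_trans (nrmB _ _) _; rewrite mulrC mulrDl.
have h1 := b1 (x - y); have h2 := b2 (x - y).
have : m * nrm (x - y) <= m * e by rewrite ler_wpM2l// ltW.
lra.
Qed.

Lemma inner_suml (I : Type) (s : seq I) (F : I -> H) y :
  inner (\sum_(i <- s) F i) y = \sum_(i <- s) inner (F i) y.
Proof.
elim: s => [|i s IH]; first by rewrite !big_nil inner0l.
by rewrite !big_cons innerDl IH.
Qed.

Lemma inner_sumr (I : Type) (s : seq I) (F : I -> H) y :
  inner y (\sum_(i <- s) F i) = \sum_(i <- s) inner y (F i).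
Proof.
elim: s => [|i s IH]; first by rewrite !big_nil inner0r.
by rewrite !big_cons innerDr IH.
Qed.

Lemma sqr_nrm_orth (x y : H) : inner x y = 0 ->
  nrm (x + y) ^+ 2 = nrm x ^+ 2 + nrm y ^+ 2.
Proof. by move=> xy; rewrite sqr_nrmD xy mulr0 addr0. Qed.

End More.

Section Gamma.
Variables (R : realType) (H HH : hilbertType R) (S : set (H * H)) (G0 G1 : H -> HH).
Hypotheses (S_closed : closed_operator S) (S_symmetric : symmetric_operator S)
  (triplet : boundary_triplet S G0 G1).
Let Sa := adjoint S.
Let A0 := A_0 S G0.

(** Index set of the gamma field: its points lie in the resolvent set of [A0], and it is stable
    under real shifts. *)
Definition nonreal := {l : R[i] | complex.Im l != 0}.

Lemma A0_res (l : nonreal) : resolvent_set A0 (val l).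
Proof. exact: A0_resolvent S_symmetric triplet _ (valP l). Qed.

(** The gamma field as a function; the default 0 of [xget] is never taken, as [G0] maps each defect
    space onto [HH]. *)
Definition gamma_map (l : nonreal) (u : HH) : H :=
  xget 0 [set f | defect_space S (val l) f /\ G0 f = u].

Local Notation gam := gamma_map.

Lemma gamP l u : defect_space S (val l) (gam l u) /\ G0 (gam l u) = u.
Proof.
rewrite /gamma_map; case: xgetP => [f _ //|h].
have [f Nf fu] := defect_solve triplet u (A0_res l).
by have := h f; case.
Qed.

Lemma gam_eq l f : defect_space S (val l) f -> f = gam l (G0 f).
Proof.
move=> Nf; have [Ng g0] := gamP l (G0 f).
exact: (defect_unique triplet (A0_res l) Nf Ng).
Qed.

Lemma gam_linear l : linear (gam l).
Proof.
move=> a u v; have [Nu u0] := gamP l u; have [Nv v0] := gamP l v.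
have [_ SD _ SZ] := adjoint_submod S.
have N : defect_space S (val l) (a *: gam l u + gam l v).
  have := SD _ _ _ _ (SZ a _ _ Nu) Nv; rewrite /defect_space /=.
  by congr (adjoint S (_, _)); rewrite scalerDr !scalerA mulrC.
rewrite (gam_eq N); congr gamma_map.
by rewrite (boundary_lin triplet (isG0 _ _) a Nu Nv) u0 v0.
Qed.

(** [gam m u - gam l u] lies in the domain of [A0], where [A0 - m] sends it to [t gam l u]. *)
Lemma gam_cont (l m : nonreal) (t : R) u : val m = val l + t%:C ->
  `|complex.Im (val l)| * nrm (gam m u - gam l u) <= `|t| * nrm (gam l u).
Proof.
move=> ml; have [Nl l0] := gamP l u; have [Nm m0] := gamP m u.
have [_ _ SB _] := adjoint_submod S.
have Ad : A0 (gam m u - gam l u, val m *: gam m u - val l *: gam l u).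
  split; first exact: SB.
  by rewrite /= (boundaryB triplet (isG0 _ _) Nm Nl) l0 m0 subrr.
have := A0_im_bound S_symmetric triplet (val m) Ad.
have -> : complex.Im (val m) = complex.Im (val l).
  by rewrite ml; case: (val l) => a b /=; rewrite addr0.
have -> : val m *: gam m u - val l *: gam l u - val m *: (gam m u - gam l u) =
    t%:C *: gam l u.
  by rewrite scalerBr opprB addrC subrKA -scalerBl ml addrAC subrr add0r.
by rewrite nrmZ nrmC.
Qed.

Lemma shift_nonreal (l : nonreal) (t : R) :
  exists m : nonreal, val m = val l + t%:C.
Proof.
have p : complex.Im (val l + t%:C) != 0.
  by have := valP l; case: (val l) => a b /=; rewrite addr0.
by exists (exist (fun z : R[i] => complex.Im z != 0) _ p).
Qed.

(** Identities obtained by dividing by a difference of spectral points fail at one point, which is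
    recovered here from its neighbours on a horizontal line. *)
Lemma gam_limit (M : set H) (l : nonreal) u : closed M ->
  (forall m : nonreal, val m <> val l -> M (gam m u)) -> M (gam l u).
Proof.
move=> Mc h; apply: Mc; apply/closureP => e e0.
have l0 : 0 < `|complex.Im (val l)| by rewrite normr_gt0 (valP l).
have p : 0 < nrm (gam l u) + 1 by rewrite ltr_wpDl ?nrm_ge0.
pose t := e * `|complex.Im (val l)| / (nrm (gam l u) + 1).
have t0 : 0 < t by rewrite divr_gt0// mulr_gt0.
have [m mt] := shift_nonreal l t.
exists (gam m u).
  apply: h; rewrite mt => /eqP; rewrite -subr_eq0 addrAC subrr add0r.
  by rewrite (inj_eq (@complexI R)) gt_eqF.
have := gam_cont u mt; rewrite (gtr0_norm t0) nrm_dist => hh.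
have te : t * (nrm (gam l u) + 1) = e * `|complex.Im (val l)|.
  by rewrite divfK// gt_eqF.
rewrite -(ltr_pM2l l0); apply: le_lt_trans hh _.
by rewrite [ltRHS]mulrC -te ltr_pM2l// ltrDl.
Qed.

Definition weyl_comm (t : HH -> HH) := forall l u,
  t (G1 (gam l u)) = G1 (gam l (t u)).

Lemma commutes_weyl_comm t : t \o t = id -> commutes_weyl S G0 G1 t -> weyl_comm t.
Proof.
move=> tt h l u; have nr : val l \isn't Num.real.
  by have := valP l; case: (val l) => a b /= b0; rewrite complex_real.
have [N g0] := gamP l u.
have := (commutesP _ tt).1 (h _ nr) u (G1 (gam l u)).
case; first by exists (gam l u) => //; rewrite g0.
by move=> f Nf [f0 <-]; rewrite (gam_eq Nf) f0.
Qed.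

Lemma intertwines_gam T t : linear T -> intertwines S G0 G1 T t ->
  forall l u, T (gam l u) = gam l (t u).
Proof.
move=> lT Tt l u; have [N g0] := gamP l u.
have [ST t0 _] := Tt _ _ N; rewrite g0 in t0; rewrite t0; apply: gam_eq.
rewrite /defect_space /=; have [_ _ _ TZ] := linear_funP lT.
by rewrite -TZ.
Qed.

Lemma intertwines_weyl_comm T t : linear T -> intertwines S G0 G1 T t -> weyl_comm t.
Proof.
move=> lT Tt l u; rewrite -(intertwines_gam lT Tt).
by have [N g0] := gamP l u; have [_ _ ->] := Tt _ _ N.
Qed.

(* Green's formula gives this unless [val l] is conjugate to [val m]; the remaining case
   follows by moving [l] parallel to the real axis. *)
Lemma gam_adjoint P P' l m u v : (forall u v, inner (P u) v = inner u (P' v)) ->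
  weyl_comm P -> weyl_comm P' ->
  inner (gam l (P u)) (gam m v) = inner (gam l u) (gam m (P' v)).
Proof.
move=> PP' cP cP'.
have main (k : nonreal) : val k <> (val m)^*%R ->
    inner (gam k (P u)) (gam m v) = inner (gam k u) (gam m (P' v)).
  move=> km; have [N1 n1] := gamP k (P u); have [N2 n2] := gamP m v.
  have [N3 n3] := gamP k u; have [N4 n4] := gamP m (P' v).
  have := green triplet N1 N2; have := green triplet N3 N4.
  rewrite n1 n2 n3 n4 -cP -cP' !innerZl !innerZr !PP' -!mulrBl => e1 e2.
  apply: (mulfI (_ : val k - (val m)^*%R != 0)); last by rewrite e1 e2.
  by rewrite subr_eq0; apply/eqP.
apply/subr0_eq.
have l0 : 0 < `|complex.Im (val l)| by rewrite normr_gt0 (valP l).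
have [lm|] := eqVneq (val l) (val m)^*%R; last by move=> /eqP/main ->; rewrite subrr.
apply: (@nrm_small _ _ _ ((nrm (gam l (P u)) * nrm (gam m v) +
  nrm (gam l u) * nrm (gam m (P' v))) / `|complex.Im (val l)|)) => e e0.
have [k ke] := shift_nonreal l e.
have /main hk : val k <> (val m)^*%R.
  rewrite ke lm => /eqP; rewrite -subr_eq0 addrAC subrr add0r.
  by rewrite (inj_eq (@complexI R)) gt_eqF.
have c1 := gam_cont (P u) ke; have c2 := gam_cont u ke.
have -> : inner (gam l (P u)) (gam m v) - inner (gam l u) (gam m (P' v)) =
    inner (gam k u - gam l u) (gam m (P' v)) -
    inner (gam k (P u) - gam l (P u)) (gam m v).
  by rewrite !innerBl hk; ring.
rewrite mulrA ler_pdivlMr// mulrC.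
apply: le_trans (_ : `|complex.Im (val l)| *
  (nrm (gam k u - gam l u) * nrm (gam m (P' v)) +
   nrm (gam k (P u) - gam l (P u)) * nrm (gam m v)) <= _).
  rewrite ler_pM2l//; apply: le_trans (nrmB _ _) _.
  by apply: lerD; exact: cauchy_schwarz.
move: c1 c2; rewrite (gtr0_norm e0) => c1 c2.
have := nrm_ge0 (gam m v); have := nrm_ge0 (gam m (P' v)).
rewrite !mulrDr !mulrA; move=> a1 a2.
by rewrite addrC lerD// ler_wpM2r.
Qed.

(** On the domain of [A0], [G1] is [gamma(conj l)^* (A0 - l)]: pairings with a single defect space
    determine it. *)
Lemma gam_dual_A0 (l : nonreal) : exists m : nonreal, forall x y u, A0 (x, y) ->
  inner (gam m u) (y - val l *: x) = inner u (G1 x).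
Proof.
have lc : complex.Im (val l)^*%R != 0.
  by rewrite conjCE; have := valP l; case: (val l) => a b /=; rewrite oppr_eq0.
pose m : nonreal := exist (fun z : R[i] => complex.Im z != 0) _ lc.
exists m => x y u Ax; have [N n0] := gamP m u.
have Ax' : A0 (x, (y - val l *: x) + val l *: x) by rewrite subrK.
have := (adjoint_gammaP S_symmetric triplet _ (G1 x) (A0_res l)).2
  (ex_intro2 _ _ x Ax' erefl).
by move=> /(_ (u, gam m u)); apply; exists (gam m u) => //; rewrite n0.
Qed.

(** Pointwise adjoint of the gamma field: it turns pairings in [H] into pairings in [HH], where
    powers of an operator are easily bounded. *)
Lemma gam_dual l h : exists g, forall u, inner (gam l u) h = inner u g.
Proof.
have rc := A0_resolvent_conj S_symmetric triplet (A0_res l).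
have [y Ay] := A0_solve rc h.
exists (G1 y) => u; have [N n0] := gamP l u.
have := (adjoint_gammaP S_symmetric triplet h (G1 y) rc).2 (ex_intro2 _ _ y Ay erefl).
rewrite conjCK => /(_ (u, gam l u)) /=.
by apply; exists (gam l u) => //; rewrite n0.
Qed.

(** [s] is a formal combination of vectors [gam l u], with [t] acting on the coefficients. Keeping
    the list makes the result available before it is known to depend boundedly on the plain sum. *)
Definition gamma_sum (t : HH -> HH) (s : seq (nonreal * HH)) : H :=
  \sum_(p <- s) gam p.1 (t p.2).

Local Notation gam_sum := gamma_sum.

Lemma gam_sum_adjoint P P' a c s s' :
  (forall u v, inner (P u) v = inner u (P' v)) -> weyl_comm P -> weyl_comm P' ->
  inner (gam_sum (P \o a) s) (gam_sum c s') =
  inner (gam_sum a s) (gam_sum (P' \o c) s').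
Proof.
move=> PP' cP cP'; rewrite /gamma_sum !inner_suml; apply: eq_bigr => p _.
rewrite !inner_sumr; apply: eq_bigr => q _.
exact: (gam_adjoint p.1 q.1 (a p.2) (c q.2) PP' cP cP').
Qed.

(** [gam_dual] expresses the moments through [B^n u] in [HH]. The resulting constant depends on [s];
    [hankel_growth] removes it and leaves the bound [b] of [B] itself. *)
Lemma gam_sum_bound B (b : R) s : 0 <= b -> weyl_comm B ->
  (forall u v, inner (B u) v = inner u (B v)) ->
  (forall u, nrm (B u) <= b * nrm u) ->
  nrm (gam_sum B s) <= b * nrm (gam_sum id s).
Proof.
move=> b0 cB sB bB.
have bit n u : nrm (iter n B u) <= b ^+ n * nrm u.
  elim: n => [|n IH]; first by rewrite expr0 mul1r.
  by rewrite exprS -mulrA /=; apply: le_trans (bB _) _; rewrite ler_wpM2l.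
have [K hK] : exists K, forall n,
    nrm (inner (gam_sum (iter n B) s) (gam_sum id s)) <= K * b ^+ n.
  move: (gam_sum id s) => h; elim: s => [|[l u] s [K hK]].
    by exists 0 => n; rewrite /gamma_sum big_nil inner0l nrm0 mul0r.
  have [g hg] := gam_dual l h; exists (nrm u * nrm g + K) => n.
  rewrite /gamma_sum big_cons innerDl mulrDl; apply: le_trans (nrmD _ _) _.
  apply: lerD; last exact: hK.
  rewrite hg /=; apply: le_trans (cauchy_schwarz _ _) _.
  by rewrite mulrAC ler_wpM2r ?nrm_ge0// mulrC.
apply: (@hankel_growth _ _ (fun n => gam_sum (iter n B) s) b K) => //.
by move=> j k; exact: (gam_sum_adjoint (iter j B) (iter k B) s s sB cB cB).
Qed.

Lemma gam_sum_cat t s s' : gam_sum t (s ++ s') = gam_sum t s + gam_sum t s'.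
Proof. by rewrite /gamma_sum big_cat. Qed.

Lemma gam_sum_map t t' s :
  gam_sum t [seq (p.1, t' p.2) | p <- s] = gam_sum (t \o t') s.
Proof. by rewrite /gamma_sum big_map. Qed.

Lemma gam_sum_lin T t : linear T -> (forall l u, T (gam l u) = gam l (t u)) ->
  forall a s, T (gam_sum a s) = gam_sum (t \o a) s.
Proof.
move=> lT Tt a s; have [T0 TD _ _] := linear_funP lT.
rewrite /gamma_sum; elim: s => [|p s IH]; first by rewrite !big_nil.
by rewrite !big_cons TD IH Tt.
Qed.

End Gamma.

(** * Lifting a symmetry of the Weyl function *)

Section Lift.
Variables (R : realType) (H HH : hilbertType R) (S : set (H * H)) (G0 G1 : H -> HH).
Hypotheses (S_closed : closed_operator S) (S_symmetric : symmetric_operator S)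
  (triplet : boundary_triplet S G0 G1).
Variables (J : H -> H) (cJ : HH -> HH).
Hypotheses (J_symmetry : fundamental_symmetry J) (SJ : commutes S J)
  (J_image : boundary_image S G0 G1 J cJ).
Variable cC : HH -> HH.
Hypotheses (cC_bounded : bounded_operator cC) (cC_inv : cC \o cC = id)
  (cC_pos : positive_operator (cJ \o cC)) (cC_weyl : commutes_weyl S G0 G1 cC).
Let Sa := adjoint S.
Let A0 := A_0 S G0.
Local Notation gam := (gamma_map S G0).
Local Notation gam_sum := (gamma_sum S G0).

Let J_symm := J_symm J_symmetry.
Let J_invol := J_invol J_symmetry.
Let J_int := J_intertwines J_symmetry SJ J_image.
Let cJ_lin := cJ_lin J_image.
Let cJ_symm := cJ_symm triplet J_symmetry SJ J_image.
Let cJ_invol := cJ_invol triplet J_symmetry SJ J_image.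
Let cJ_nrm := cJ_nrm triplet J_symmetry SJ J_image.

Lemma J_lin : linear J.
Proof. by case: J_symmetry => -[[]]. Qed.

Lemma cC_lin : linear cC. Proof. by case: cC_bounded. Qed.

Lemma cC_K u : cC (cC u) = u.
Proof. by rewrite -[LHS]/((cC \o cC) u) cC_inv. Qed.

Let cC' := cJ \o cC \o cJ.

Lemma cC_adj u v : inner (cC u) v = inner u (cC' v).
Proof.
have [_ sT _ _] := positive_operatorE cC_pos.
by have := sT u (cJ v); rewrite /= cJ_symm cJ_invol.
Qed.

Lemma cC'_adj u v : inner (cC' u) v = inner u (cC v).
Proof. by rewrite innerC -cC_adj -innerC. Qed.

Lemma cC'_K u : cC' (cC' u) = u.
Proof. by rewrite /cC' /= cJ_invol cC_K cJ_invol. Qed.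

Lemma cC_comm : weyl_comm S G0 G1 cC.
Proof. exact: (commutes_weyl_comm S_symmetric triplet cC_inv cC_weyl). Qed.

Lemma cJ_comm : weyl_comm S G0 G1 cJ.
Proof. exact: (intertwines_weyl_comm S_symmetric triplet J_lin J_int). Qed.

Lemma comp_comm t1 t2 : weyl_comm S G0 G1 t1 -> weyl_comm S G0 G1 t2 ->
  weyl_comm S G0 G1 (t1 \o t2).
Proof. by move=> h1 h2 l u; rewrite /= h2 h1. Qed.

Lemma cC'_comm : weyl_comm S G0 G1 cC'.
Proof. exact: comp_comm (comp_comm cJ_comm cC_comm) cJ_comm. Qed.

Lemma J_gam l u : J (gam l u) = gam l (cJ u).
Proof. exact: (intertwines_gam S_symmetric triplet J_lin J_int). Qed.

(** The part of [H] invisible to the Weyl function. It is invariant under [J], on which the choice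
    [C = J] relies. *)
Definition gam_perp := [set z : H | forall l u, inner (gam l u) z = 0].

Lemma J_perp z : gam_perp z -> gam_perp (J z).
Proof. by move=> hz l u; rewrite -J_symm J_gam hz. Qed.

Lemma gam_sum_perp t s z : gam_perp z -> inner (gam_sum t s) z = 0.
Proof. by move=> hz; rewrite inner_suml big1. Qed.

Lemma perp_submod : submod_closed (mem gam_perp).
Proof.
apply: submodI => [l u|a x y hx hy l u]; first by rewrite inner0r.
by rewrite innerDr innerZr hx hy mulr0 addr0.
Qed.

Definition gam_dom :=
  [set f : H | exists s z, gam_perp z /\ f = gam_sum id s + z].

Lemma gam_dom_submod : submod_closed (mem gam_dom).
Proof.
have [P0 PD _ PZ] := submodP perp_submod.
apply: submodI.
  by exists [::], 0; split=> //; rewrite /gamma_sum big_nil addr0.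
move=> a _ _ [s [z [hz ->]]] [s' [z' [hz' ->]]].
exists ([seq (p.1, a *: p.2) | p <- s] ++ s'), (a *: z + z').
split; first exact: PD (PZ a _ hz) hz'.
rewrite gam_sum_cat gam_sum_map scalerDr addrACA; congr (_ + _ + _).
apply: (gam_sum_lin (T := fun x => a *: x) (t := fun u => a *: u)).
  by move=> b x y; rewrite scalerDr !scalerA mulrC.
move=> l u; have := gam_linear S_symmetric triplet l.
by move=> /linear_funP[_ _ _ ->].
Qed.

Lemma gam_in_dom l u : gam_dom (gam l u).
Proof.
exists [:: (l, u)], 0; have [P0 _ _ _] := submodP perp_submod.
by split=> //; rewrite /gamma_sum big_seq1 addr0.
Qed.

Lemma perp_in_dom z : gam_perp z -> gam_dom z.
Proof.
by exists [::], z; split=> //; rewrite /gamma_sum big_nil add0r.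
Qed.

(** A vector orthogonal to [M] is orthogonal to all [gam l u], so it lies in [gam_perp], hence in
    [M], and is orthogonal to itself. *)
Lemma total_full (M : set H) : submod_closed (mem M) -> closed M ->
  (forall l u, M (gam l u)) -> (forall z, gam_perp z -> M z) -> forall x, M x.
Proof.
move=> Ms Mc Mg Mp; apply: (closed_full Ms Mc) => w hw.
apply: inner_eq0; apply/hw/Mp => l u.
by rewrite innerC hw ?conjC0.
Qed.

Lemma gam_dom_dense x (e : R) : 0 < e -> exists2 f, gam_dom f & nrm (x - f) < e.
Proof.
have cl := @total_full (closure gam_dom) (closure_submod gam_dom_submod)
  (@closed_closure _ _).
have /closureP : closure gam_dom x; last exact.
apply: cl => [l u|z hz]; apply: subset_closure; first exact: gam_in_dom.
exact: perp_in_dom.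
Qed.

(* The lift is the adjoint of [lift_graph cC'] rather than the closure of [lift_graph cC]:
   it is then closed and linear for free, and inherits [C^2 = 1]. *)
Definition lift_graph (t : HH -> HH) : set (H * H) :=
  [set p | exists s z, gam_perp z /\ p = (gam_sum id s + z, gam_sum t s + J z)].

Lemma lift_graph_adjoint : lift_graph cC `<=` adjoint (lift_graph cC').
Proof.
move=> _ [s [z [hz ->]]] _ [s' [z' [hz' ->]]] /=.
rewrite !innerDl !innerDr !(gam_sum_perp _ _ hz) !(gam_sum_perp _ _ (J_perp hz)).
rewrite (innerC z' (gam_sum _ _)) (innerC (J z') (gam_sum _ _)).
rewrite (gam_sum_perp _ _ hz') (gam_sum_perp _ _ (J_perp hz')).
rewrite !conjC0 !add0r !addr0 J_symm; congr (_ + _).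
exact: (gam_sum_adjoint S_symmetric triplet id id s' s cC'_adj cC'_comm cC_comm).
Qed.

Lemma cC_bnd : exists2 b : R, 0 <= b & forall u, nrm (cC u) <= b * nrm u.
Proof. by have /bounded_operatorP[] := cC_bounded. Qed.

(** The squared norm of the [cC']-sum is the pairing of the plain sum with the [cC cC']-sum, and
    [cC cC'] is symmetric although [cC'] need not be. *)
Lemma lift_graph_bound : exists2 m : R, 0 <= m &
  forall f g, lift_graph cC' (f, g) -> nrm g <= m * nrm f.
Proof.
have [b b0 hb] := cC_bnd.
pose B := cC \o cC'.
have B1 u : nrm (B u) <= b ^+ 2 * nrm u.
  rewrite /B /= expr2 -mulrA; apply: le_trans (hb _) _; rewrite ler_wpM2l//.
  by rewrite cJ_nrm -[X in _ <= b * X]cJ_nrm.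
have B2 : weyl_comm S G0 G1 B by exact: comp_comm cC_comm cC'_comm.
have B3 u v : inner (B u) v = inner u (B v).
  by rewrite /B [LHS]cC_adj [LHS]cC'_adj.
(* The two orthogonal parts carry the factors [b] and 1; [b^2 + 1] is at least as large as both. *)
exists (b ^+ 2 + 1); first by rewrite addr_ge0 ?sqr_ge0.
move=> _ _ [s [z [hz [-> ->]]]].
have e1 := sqr_nrm_orth (gam_sum_perp id s hz).
have e2 := sqr_nrm_orth (gam_sum_perp cC' s (J_perp hz)).
have h1 := gam_sum_bound S_symmetric triplet s (sqr_ge0 b) B2 B3 B1.
have h2 : nrm (gam_sum cC' s) ^+ 2 <= b ^+ 2 * nrm (gam_sum id s) ^+ 2.
  rewrite sqr_nrm.
  rewrite (gam_sum_adjoint S_symmetric triplet id cC' s s cC'_adj cC'_comm cC_comm).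
  apply: le_trans (Re_le_nrm _) _; apply: le_trans (cauchy_schwarz _ _) _.
  by rewrite mulrC [X in _ <= _ * X]expr2 mulrA ler_wpM2r ?nrm_ge0.
have h3 : nrm (J z) = nrm z.
  by apply: (involution_nrm _ J_symm); case: J_symmetry.
have q0 : 0 <= b ^+ 2 by exact: sqr_ge0.
rewrite -ler_sqr ?nnegrE ?nrm_ge0 ?mulr_ge0 ?addr_ge0 ?nrm_ge0// exprMn e1 e2 h3.
have := sqr_ge0 (nrm (gam_sum id s)); have := sqr_ge0 (nrm z).
set x := nrm z ^+ 2; set y := nrm (gam_sum id s) ^+ 2 in h2 *.
set w := b ^+ 2 in q0 h2 *; move: h2; set v := nrm _ ^+ 2; nra.
Qed.

(** The adjoint of a bounded operator on a dense domain is bounded: [f] in [gam_dom] is taken close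
    to [y] in the estimate of [<f, y>]. *)
Lemma lift_bound : exists2 m : R, 0 <= m &
  forall x y, adjoint (lift_graph cC') (x, y) -> nrm y <= m * nrm x.
Proof.
have [m m0 hm] := lift_graph_bound; exists m => // x y hxy.
have h f : gam_dom f -> nrm (inner f y) <= m * nrm f * nrm x.
  move=> [s [z [hz ->]]].
  have E : lift_graph cC' (gam_sum id s + z, gam_sum cC' s + J z) by exists s, z.
  have := hxy _ E => /= <-; apply: le_trans (cauchy_schwarz _ _) _.
  by rewrite ler_wpM2r ?nrm_ge0//; exact: hm.
have [y0|yn0] := eqVneq (nrm y) 0; first by rewrite y0 mulr_ge0 ?nrm_ge0.
have yp : 0 < nrm y by rewrite lt_def yn0 nrm_ge0.
rewrite -(ler_pM2r yp); apply/ler_addgt0Pr => e e0.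
have p : 0 < nrm y + m * nrm x + 1.
  by have := nrm_ge0 x; have := mulr_ge0 m0 (nrm_ge0 x); lra.
have [f df yf] := gam_dom_dense y (divr_gt0 e0 p).
have h1 : nrm y * nrm y <= nrm (inner (y - f) y) + nrm (inner f y).
  apply: le_trans (nrmD _ _); rewrite -innerDl subrK inner_nrm nrmC.
  by rewrite ger0_norm ?sqr_ge0// expr2.
have h2 := cauchy_schwarz (y - f) y; have h3 := h _ df.
have h4 : nrm f <= nrm y + nrm (y - f).
  by rewrite -{1}(subKr y f); exact: nrmB.
move: yf; rewrite ltr_pdivlMr// => yf.
have h5 : m * nrm x * nrm f <= m * nrm x * (nrm y + nrm (y - f)).
  by rewrite ler_wpM2l// mulr_ge0// nrm_ge0.
have := nrm_ge0 (y - f); nra.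
Qed.

(** The domain of the adjoint is closed by [lift_bound] and contains the generators by
    [lift_graph_adjoint], so it is all of [H]. *)
Lemma lift_exists : exists C : H -> H, [/\ linear C,
  exists2 m : R, 0 <= m & forall x, nrm (C x) <= m * nrm x &
  forall x y, adjoint (lift_graph cC') (x, y) <-> y = C x].
Proof.
have [m m0 hm] := lift_bound.
have Acl := adjoint_closed (lift_graph cC').
have [A00 AD AB AZ] := submod2P Acl.1.
have full x : reldom (adjoint (lift_graph cC')) x.
  move: x; apply: total_full (closed_reldom Acl hm) _ _.
  - apply: submodI => [|a x y [x' Ax] [y' Ay]]; first by exists 0.
    by exists (a *: x' + y'); exact: AD (AZ a _ _ Ax) Ay.
  - move=> l u; have [s [z [hz e]]] := gam_in_dom l u.
    exists (gam_sum cC s + J z); apply: lift_graph_adjoint.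
    by exists s, z; split=> //; rewrite e.
  - move=> w hw; have [s [z [hz e]]] := perp_in_dom hw.
    exists (gam_sum cC s + J z); apply: lift_graph_adjoint.
    by exists s, z; split=> //; rewrite e.
have [C hC] := choice full.
have un x y : adjoint (lift_graph cC') (x, y) -> y = C x.
  move=> hxy; apply/subr0_eq/nrm_eq0/le_anti; rewrite nrm_ge0 andbT.
  by have := hm _ _ (AB _ _ _ _ hxy (hC x)); rewrite subrr nrm0 mulr0.
exists C; split.
- move=> a x y; apply/esym/un; exact: AD (AZ a _ _ (hC x)) (hC y).
- by exists m => // x; exact: hm.
- by move=> x y; split=> [/un//|->].
Qed.

Lemma i_nonreal : complex.Im ('i%C : R[i]) != 0.
Proof. by rewrite /= oner_neq0. Qed.

Let ii : nonreal R := exist (fun z : R[i] => complex.Im z != 0) _ i_nonreal.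

(** The resolvent identity [(A0 - i)^-1 gamma(l) = (gamma(i) - gamma(l)) / (i - l)]. *)
Lemma A0_gam l u : val l <> 'i%C ->
  A0 (('i%C - val l)^-1 *: (gam ii u - gam l u),
      gam l u + 'i%C *: (('i%C - val l)^-1 *: (gam ii u - gam l u))).
Proof.
move=> li; have [Ni i0] := gamP S_symmetric triplet ii u.
have [Nl l0] := gamP S_symmetric triplet l u.
have [_ _ SB SZ] := adjoint_submod S.
have a0 : 'i%C - val l != 0 by rewrite subr_eq0 eq_sym; apply/eqP.
have Sd := SB _ _ _ _ Ni Nl; split; last first.
  by rewrite /= (boundaryZ triplet (isG0 _ _) _ Sd) (boundaryB triplet (isG0 _ _) Ni Nl)
    i0 l0 subrr scaler0.
have := SZ ('i%C - val l)^-1 _ _ Sd; congr (adjoint S (_, _)).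
apply: (scalerI a0); rewrite scalerA mulfV// scale1r [RHS]scalerDr !scalerA.
by rewrite [_ * 'i%C]mulrC mulfK// scalerBl [in RHS]scalerBr [RHS]addrC subrKA.
Qed.

(** Invariance of the complement under the resolvent of [A0] at [i]. The duality of [gam_dual_A0]
    gives [G1 x = 0], after which Green's identity yields [(l + i) <gam l u, x> = 0]; [l = -i] is
    reached by a limit. *)
Lemma gam_perp_A0 x y : A0 (x, y) -> gam_perp (y - 'i%C *: x) -> gam_perp x.
Proof.
move=> [/= Sx x0] hz.
have x1 : G1 x = 0.
  have [ic dual] := gam_dual_A0 S_symmetric triplet ii.
  by apply: inner_injr => u; rewrite inner0r -(dual x y)//; exact: hz.
have main l u : val l <> - 'i%C -> inner (gam l u) x = 0.
  move=> li; have [N n0] := gamP S_symmetric triplet l u.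
  have := green triplet N Sx; rewrite x0 x1 !inner0r subrr innerZl.
  have -> : inner (gam l u) y = ('i%C)^*%R * inner (gam l u) x.
    by rewrite -innerZr; apply/subr0_eq; rewrite -innerBr hz.
  rewrite -mulrBl => /eqP; rewrite mulf_eq0 => /orP[|/eqP//].
  rewrite subr_eq0 => /eqP lE; case: li; rewrite lE conjCE; apply/eqP.
  by rewrite eq_complex /= oppr0 !eqxx.
move=> l u; have [li|/eqP] := eqVneq (val l) (- 'i%C); last exact: main.
apply: (gam_limit S_symmetric triplet (M := [set f | inner f x = 0])).
  exact: closed_perp.
by move=> k; rewrite li; exact: main.
Qed.

Lemma J_A0 x y : A0 (x, y) -> A0 (J x, J y).
Proof.
move=> [/= Sx x0]; have [SJx J0 _] := J_int Sx.
by split=> //=; rewrite -J0 x0; case: (linear_funP cJ_lin).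
Qed.

Section WithC.
Variable C : H -> H.
Hypotheses (C_lin : linear C)
  (C_graph : forall x y, adjoint (lift_graph cC') (x, y) <-> y = C x).
Variable m : R.
Hypotheses (m0 : 0 <= m) (C_bnd : forall x, nrm (C x) <= m * nrm x).

Lemma lift_sum s z : gam_perp z -> C (gam_sum id s + z) = gam_sum cC s + J z.
Proof.
by move=> hz; apply/esym/C_graph; apply: lift_graph_adjoint; exists s, z.
Qed.

Lemma lift_gam l u : C (gam l u) = gam l (cC u).
Proof.
have [P0 _ _ _] := submodP perp_submod.
have := lift_sum [:: (l, u)] P0.
have [-> _ _ _] := linear_funP J_lin.
by rewrite /gamma_sum !big_seq1 !addr0.
Qed.

Lemma lift_perp z : gam_perp z -> C z = J z.
Proof.
move=> hz; have := lift_sum [::] hz.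
by rewrite /gamma_sum !big_nil !add0r.
Qed.

Lemma lift_dual x l u : inner (gam l (cC' u)) x = inner (gam l u) (C x).
Proof.
have [P0 _ _ _] := submodP perp_submod.
have /(_ (gam l u, gam l (cC' u))) := (C_graph x (C x)).2 erefl.
apply; exists [:: (l, u)], 0; split=> //.
have [-> _ _ _] := linear_funP J_lin.
by rewrite /gamma_sum !big_seq1 !addr0.
Qed.

Lemma lift_invol x : C (C x) = x.
Proof.
apply/esym/C_graph => _ [s [z [hz ->]]] /=.
(* [lift_graph cC'] is invariant under exchanging the two components, because [cC'] and [J] are
   involutions; so is its adjoint, the graph of [C]. *)
have E : lift_graph cC' (gam_sum cC' s + J z, gam_sum id s + z).
  exists [seq (p.1, cC' p.2) | p <- s], (J z); split; first exact: J_perp.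
  rewrite !gam_sum_map J_invol; congr (_, _ + _).
  by congr gamma_sum; apply/funext => u; rewrite /= -[LHS]cC'_K.
by have := (C_graph x (C x)).2 erefl _ E => /= <-.
Qed.

(** On [gam_dom], [JCJ] acts by [cJ cC cJ = cC'] on coefficients and by [J] on the complement, which
    is [lift_graph cC']; density extends the identity. *)
Lemma lift_adjoint f x : inner (J (C (J f))) x = inner f (C x).
Proof.
have dom g : gam_dom g -> inner (J (C (J g))) x = inner g (C x).
  move=> [s [z [hz ->]]].
  have E : lift_graph cC' (gam_sum id s + z, gam_sum cC' s + J z) by exists s, z.
  have /= := (C_graph x (C x)).2 erefl _ E => <-.
  suff -> : J (C (J (gam_sum id s + z))) = gam_sum cC' s + J z by [].
  have [_ JD _ _] := linear_funP J_lin.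
  rewrite JD (gam_sum_lin J_lin J_gam).
  have -> : gamma_sum S G0 (cJ \o id) s = gam_sum id [seq (p.1, cJ p.2) | p <- s].
    by rewrite gam_sum_map.
  rewrite lift_sum; last exact: J_perp.
  rewrite JD J_invol; congr (_ + _).
  by rewrite (gam_sum_lin J_lin J_gam) gam_sum_map.
have [_ _ CB _] := linear_funP C_lin; have [_ _ JB _] := linear_funP J_lin.
apply/subr0_eq; apply: (@nrm_small _ _ _ (m * nrm x + m * nrm x)) => e e0.
have [g dg fg] := gam_dom_dense f e0.
have -> : inner (J (C (J f))) x - inner f (C x) =
    inner (J (C (J (f - g)))) x - inner (f - g) (C x).
  by rewrite !JB CB JB !innerBl (dom g dg); ring.
have nJ := involution_nrm (proj2 J_symmetry) J_symm.
apply: le_trans (nrmB _ _) _; rewrite mulrDr; apply: lerD.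
  apply: le_trans (cauchy_schwarz _ _) _; rewrite nJ mulrA ler_wpM2r ?nrm_ge0//.
  apply: le_trans (C_bnd _) _; rewrite nJ mulrC ler_wpM2r//; exact: ltW.
apply: le_trans (cauchy_schwarz _ _) _; apply: ler_pM; rewrite ?nrm_ge0//; exact: ltW.
Qed.

Lemma lift_JC_symm x y : inner (J (C x)) y = inner x (J (C y)).
Proof. by rewrite -[x in LHS]J_invol lift_adjoint J_symm. Qed.

(** On [gam_dom] the form splits into [|z|^2] and the pairing of the [cJ cC]-sum with the plain sum,
    whose positivity comes from [gam_sum_bound] for [b - cJ cC]. A negative value at [x] would
    persist at nearby points. *)
Lemma lift_JC_form x : 0 <= complex.Re (inner (J (C x)) x).
Proof.
have [lt st pt [b b0 bt]] := positive_operatorE cC_pos.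
have dom g : gam_dom g -> 0 <= complex.Re (inner (J (C g)) g).
  move=> [s [z [hz ->]]]; have [_ JD _ _] := linear_funP J_lin.
  rewrite lift_sum// JD J_invol (gam_sum_lin J_lin J_gam).
  rewrite innerDl !innerDr (gam_sum_perp _ _ hz) (innerC z (gam_sum _ _)).
  rewrite (gam_sum_perp _ _ hz) conjC0.
  rewrite addr0 add0r raddfD /= addr_ge0//; last by rewrite -sqr_nrm sqr_ge0.
  (* A constant function is enough, as [form_of_shift] looks at a single vector. *)
  apply: (@form_of_shift _ _ (fun=> gam_sum (cJ \o cC) s) b) => //.
  have := gam_sum_bound S_symmetric triplet (B := fun u => b%:C *: u - (cJ \o cC) u) s b0.
  have -> : gamma_sum S G0 (fun u => b%:C *: u - (cJ \o cC) u) s =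
      b%:C *: gam_sum id s - gam_sum (cJ \o cC) s.
    rewrite /gamma_sum scaler_sumr -sumrB; apply: eq_bigr => p _.
    have [_ _ gB gZ] := linear_funP (gam_linear S_symmetric triplet p.1).
    by rewrite gB gZ.
  apply.
  - move=> l u; have [N n0] := gamP S_symmetric triplet l u.
    have [N1 n1] := gamP S_symmetric triplet l ((cJ \o cC) u).
    have [_ _ gB gZ] := linear_funP (gam_linear S_symmetric triplet l).
    have [_ _ _ SZ] := adjoint_submod S.
    rewrite gB gZ (boundaryB triplet (isG1 _ _) (SZ b%:C _ _ N) N1).
    by rewrite (boundaryZ triplet (isG1 _ _) _ N) /= -cJ_comm -cC_comm.
  - by move=> u v; rewrite innerBl innerBr innerZl innerZr conjR st.
  - exact: positive_form_shift.
rewrite leNgt; apply/negP; set r := complex.Re _ => r0.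
have [_ _ CB _] := linear_funP C_lin; have [_ _ JB _] := linear_funP J_lin.
have nJ := involution_nrm (proj2 J_symmetry) J_symm.
(* If [d = |x - g| <= 1], passing from [x] to [g] changes the form by at most [d (2 m |x| + m)].
   Taking [d] below [- r] over this denominator gives the contradiction; the added 1 keeps it
   positive. *)
have p : 0 < 2 * m * nrm x + m + 1.
  by have := mulr_ge0 m0 (nrm_ge0 x); have := m0; rewrite -mulrA; lra.
have q0 : 0 < Num.min 1 (- r / (2 * m * nrm x + m + 1)).
  by rewrite lt_min ltr01 divr_gt0// oppr_gt0.
have [g dg] := gam_dom_dense x q0.
rewrite lt_min ltr_pdivlMr// => /andP[e1 e2].
have e : inner (J (C x)) x = inner (J (C g)) g +
    (inner (J (C (x - g))) x + inner (J (C g)) (x - g)).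
  by rewrite CB JB !innerBl !innerBr; ring.
have h1 := cauchy_schwarz (J (C (x - g))) x.
have h2 := cauchy_schwarz (J (C g)) (x - g).
have h3 := Re_le_nrm (- (inner (J (C (x - g))) x + inner (J (C g)) (x - g))).
rewrite nrmN in h3.
have h4 := nrmD (inner (J (C (x - g))) x) (inner (J (C g)) (x - g)).
move: h1 h2; rewrite !nJ => h1 h2.
have h5 : nrm g <= nrm x + nrm (x - g) by rewrite -{1}(subKr x g); exact: nrmB.
have := congr1 (@complex.Re R) e; rewrite -/r raddfD /= => er.
have h6 := dom g dg; rewrite raddfN /= in h3.
have h7 := C_bnd (x - g); have h8 := C_bnd g.
set d := nrm (x - g) in e1 e2 h1 h2 h5 h7 *.
have d0 : 0 <= d by exact: nrm_ge0.
have h9 : nrm (C (x - g)) * nrm x <= m * d * nrm x.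
  by rewrite ler_wpM2r ?nrm_ge0.
have h10 : nrm (C g) * d <= m * (nrm x + d) * d.
  by rewrite ler_wpM2r// (le_trans h8)// ler_wpM2l.
have h11 : m * d * d <= m * d * 1 by rewrite ler_wpM2l ?mulr_ge0// ltW.
lra.
Qed.

Lemma lift_JC_positive : positive_operator (J \o C).
Proof.
have nJ := involution_nrm (proj2 J_symmetry) J_symm.
apply: (@positive_operatorI _ _ _ m) => //.
- by move=> a x y /=; rewrite C_lin J_lin.
- by move=> x /=; rewrite nJ.
- exact: lift_JC_symm.
- exact: lift_JC_form.
- move=> x /= h; rewrite -(lift_invol x) -(J_invol (C x)) h.
  have [-> _ _ _] := linear_funP J_lin.
  by have [-> _ _ _] := linear_funP C_lin.
Qed.

(** Equivalently [C] commutes with the resolvent of [A0] at [i], a closed condition: it is tested on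
    [gam l u] through [A0_gam], and on [gam_perp], which the resolvent preserves and where
    [C = J]. *)
Lemma lift_A0 x y : A0 (x, y) -> A0 (C x, C y).
Proof.
have [B /bounded_operatorP[lB [b b0 bB]] rB] :=
  A0_resolvent S_symmetric triplet i_nonreal.
have hB u v := resolvent_graph rB u v.
have hBs h : A0 (B h, h + 'i%C *: B h) by apply/hB; rewrite addrK.
have hBu u h : A0 (u, h + 'i%C *: u) -> B h = u by move=> /hB ->; rewrite addrK.
have CB h : C (B h) = B (C h).
  have mb : 0 <= m * b by rewrite mulr_ge0.
  have [] := @closed_equalizer _ _ (C \o B) (B \o C) (m * b) mb.
  - by move=> a u v /=; rewrite lB C_lin.
  - by move=> a u v /=; rewrite C_lin lB.
  - by move=> u /=; apply: le_trans (C_bnd _) _; rewrite -mulrA ler_wpM2l.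
  - by move=> u /=; apply: le_trans (bB _) _; rewrite [m * b]mulrC -mulrA ler_wpM2l.
  move=> Es Ec; apply: (total_full Es Ec) => [l u|z hz] /=.
    have main k : val k <> 'i%C -> C (B (gam k u)) = B (C (gam k u)).
      move=> ki; rewrite lift_gam (hBu _ _ (A0_gam u ki)).
      rewrite (hBu _ _ (A0_gam (cC u) ki)).
      by have [_ _ CB CZ] := linear_funP C_lin; rewrite CZ CB !lift_gam.
    have [li|/eqP] := eqVneq (val l) 'i%C; last exact: main.
    apply: (gam_limit S_symmetric triplet Ec) => k; rewrite li; exact: main.
  have hBz : gam_perp (B z) by apply: (gam_perp_A0 (hBs z)); rewrite addrK.
  rewrite !lift_perp//; apply/esym/hBu.
  have [_ JD _ JZ] := linear_funP J_lin.
  by rewrite -JZ -JD; exact/J_A0/hBs.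
move=> /hB xE; apply/hB; have [_ _ CB' CZ] := linear_funP C_lin.
by rewrite {1}xE CB CB' CZ.
Qed.

(** [G1] is recovered from pairings with one defect space, and [lift_dual] moves [C] across these
    pairings to [cC']. *)
Lemma lift_A0_G1 x y : A0 (x, y) -> G1 (C x) = cC (G1 x).
Proof.
move=> Ax; have ACx := lift_A0 Ax.
have [ic dual] := gam_dual_A0 S_symmetric triplet ii.
apply: inner_injr => w; rewrite -(dual _ _ _ ACx).
have [_ _ CB CZ] := linear_funP C_lin.
by rewrite -CZ -CB -lift_dual (dual _ _ _ Ax) cC'_adj.
Qed.

(** The domain of [Sa] is the sum of that of [A0] and the defect space at [i]: [lift_A0] and
    [lift_A0_G1] settle the first part, [lift_gam] and [cC_comm] the second. *)
Lemma lift_intertwines : intertwines S G0 G1 C cC.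
Proof.
move=> f f' Sf; have [N n0] := gamP S_symmetric triplet ii (G0 f).
have [NC nC] := gamP S_symmetric triplet ii (cC (G0 f)).
have [_ SD SB _] := adjoint_submod S.
have Sd := SB _ _ _ _ Sf N.
have Ad : A0 (f - gam ii (G0 f), f' - 'i%C *: gam ii (G0 f)).
  by split=> //=; rewrite (boundaryB triplet (isG0 _ _) Sf N) n0 subrr.
have ACd := lift_A0 Ad; have [/= SCd g0] := ACd; have g1 := lift_A0_G1 Ad.
have [_ CD CB CZ] := linear_funP C_lin.
have [_ _ cB _] := linear_funP cC_lin.
have ef : C f = C (f - gam ii (G0 f)) + gam ii (cC (G0 f)).
  by rewrite CB lift_gam subrK.
have ef' : C f' = C (f' - 'i%C *: gam ii (G0 f)) + 'i%C *: gam ii (cC (G0 f)).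
  by rewrite CB CZ lift_gam subrK.
rewrite ef ef'; split; first exact: SD SCd NC.
  by rewrite (boundaryD triplet (isG0 _ _) SCd NC) g0 nC add0r.
rewrite (boundaryD triplet (isG1 _ _) SCd NC) g1 (boundaryB triplet (isG1 _ _) Sf N) cB.
by rewrite -cC_comm subrK.
Qed.

Lemma lift_C_symmetry : C_symmetry_of S J C.
Proof.
have CC : C \o C = id by apply/funext => x; exact: lift_invol.
split=> //.
- by apply/bounded_operatorP; split=> //; exists m.
- exact: lift_JC_positive.
- apply/(commutesP _ CC) => x y Sx.
  (* [S] is recognised inside [Sa] by its vanishing boundary values, which the intertwining
     relations preserve. *)
  have [Sax x0 x1] := boundary_S S_symmetric triplet Sx.
  have [SCx c0 c1] := lift_intertwines Sax.
  have [c00 _ _ _] := linear_funP cC_lin.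
  by apply: (S_boundary S_closed S_symmetric triplet SCx); rewrite -?c0 -?c1 ?x0 ?x1 c00.
Qed.

End WithC.

Lemma lift_symmetry :
  exists2 C, C_symmetry_of S J C & intertwines S G0 G1 C cC.
Proof.
have [C [C_lin [m m0 C_bnd] C_graph]] := lift_exists.
exists C; first exact: lift_C_symmetry C_lin C_graph _ m0 C_bnd.
exact: lift_intertwines C_lin C_graph _ m0 C_bnd.
Qed.

End Lift.

(** * Stable extensions and admissible parameters *)

Section Main.
Variables (R : realType) (H HH : hilbertType R) (S : set (H * H)) (G0 G1 : H -> HH).
Hypotheses (S_closed : closed_operator S) (S_dense : densely_defined S)
  (S_symmetric : symmetric_operator S) (triplet : boundary_triplet S G0 G1).
Variables (J : H -> H) (cJ : HH -> HH).
Hypotheses (J_symmetry : fundamental_symmetry J) (SJ : commutes S J)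
  (J_image : boundary_image S G0 G1 J cJ).
Let Sa := adjoint S.
Let A0 := A_0 S G0.

Lemma stable_extension (A : set (H * H)) C cC : closed_relation A -> Sigma S J A ->
  C_symmetry_of S J C -> commutes A C -> boundary_image S G0 G1 C cC ->
  (forall mu : R[i], complex.Im mu != 0 -> resolvent_set A mu) /\
  exists2 K, A = extension_of S G0 G1 K & admissible_parameter S G0 G1 cJ K cC.
Proof.
move=> Acl [As _ SA [_ AJ]] C_sym AC C_image.
have JJ := J_symmetry.2; have CC : C \o C = id by case: C_sym.
move/(J_selfadjointP _ JJ): AJ => AJ; move/(commutesP _ CC): AC => AC.
split; first exact: (symmetric_extension_resolvent J_symmetry Acl C_sym AJ AC).
have ASa : A `<=` Sa.
  move=> [x y] /AJ h; rewrite -(J_invol J_symmetry x) -(J_invol J_symmetry y).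
  suff /(J_intertwines J_symmetry SJ J_image)[] : Sa (J x, J y) by [].
  by move=> p /SA; exact: h.
have [K Ks AK] := boundary_parameter S_closed S_symmetric triplet As SA ASa.
exists K => //; rewrite AK in AJ AC.
have KJ := (extension_J_selfadjoint S_symmetric triplet J_symmetry SJ J_image Ks).1 AJ.
have Cc := C_intertwines J_symmetry SJ C_sym C_image.
have cc := cC_involution triplet J_symmetry SJ C_sym C_image.
split.
- by split; [rewrite KJ; exact: J_orthogonal_closed|exact: KJ].
- split=> //.
  + exact: (cC_bounded triplet J_symmetry SJ J_image C_sym C_image).
  + exact: (cJcC_positive triplet J_symmetry SJ J_image C_sym C_image).
  + exact: (extension_commutes triplet _ Cc cc).1.
- exact: (cC_weyl triplet J_symmetry SJ C_sym C_image).
Qed.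

Lemma admissible_extension K cC : admissible_parameter S G0 G1 cJ K cC ->
  single_valued (extension_of S G0 G1 K) ->
  Sigma S J (extension_of S G0 G1 K) /\
  exists2 C, C_symmetry_of S J C & commutes (extension_of S G0 G1 K) C.
Proof.
move=> [[[Ks _] KJ] [cCb cc cCp KC] cCw] sv; split.
  split=> //.
  - exact: extension_submod.
  - exact: extension_S.
  - split; last first.
      apply/(J_selfadjointP _ J_symmetry.2).
      exact/(extension_J_selfadjoint S_symmetric triplet J_symmetry SJ J_image Ks).
    move=> O O0 Oo; have [x [Ox [y Sxy]]] := S_dense O0 Oo.
    by exists x; split=> //; exists y; exact: (extension_S S_symmetric triplet Ks).
have [C C_sym Cc] := lift_symmetry S_closed S_symmetric triplet J_symmetry
  SJ J_image cCb cc cCp cCw.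
exists C => //; have CC : C \o C = id by case: C_sym.
by apply/(commutesP _ CC); apply/(extension_commutes triplet _ Cc cc).
Qed.

(** Elements of the common domain have boundary values [(0, v)] with [v] in the multivalued part of
    [K], and they lie in the domain of [S] exactly when [v = 0]. *)
Lemma disjoint_extension (K : set (HH * HH)) : submod_closed (mem K) ->
  disjoint_extensions S (extension_of S G0 G1 K) A0 <-> single_valued K.
Proof.
move=> Ks; have [K0 _ KB _] := submod2P Ks; split=> [dj u v w Kv Kw|sv].
  have [f [f' [Sf f0 f1]]] := boundary_surj triplet 0 (v - w).
  have : (reldom (extension_of S G0 G1 K) `&` reldom A0) f.
    split; exists f'; split=> //=; rewrite f0 f1.
    by have := KB _ _ _ _ Kv Kw; rewrite subrr.
  by rewrite dj => -[g /(boundary_S S_symmetric triplet)[_ _]]; rewrite f1 => /subr0_eq.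
apply/seteqP; split=> [x [[y [/= Sx Kx]] [z [/= Sz x0]]]|x [y Sxy]].
  exists y; apply: (S_boundary S_closed S_symmetric triplet Sx x0).
  by rewrite x0 in Kx; exact: (sv _ _ _ Kx K0).
split; exists y; first exact: (extension_S S_symmetric triplet Ks).
by have [Sx x0 _] := boundary_S S_symmetric triplet Sxy; split.
Qed.

(** Transversality makes the operator [K] everywhere defined; boundedness is then automatic, as
    [cJ]-symmetry provides the formal adjoint [cJ B cJ] for [hellinger_toeplitz]. *)
Lemma transversal_extension (K : set (HH * HH)) : submod_closed (mem K) ->
  (forall f g, K f -> K g -> inner (cJ f.2) g.1 = inner (cJ f.1) g.2) ->
  transversal_extensions S (extension_of S G0 G1 K) A0 <->
  exists2 B : HH -> HH, bounded_operator B & K = graph B.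
Proof.
move=> Ks KJ; have [K0 KD KB KZ] := submod2P Ks.
rewrite /transversal_extensions disjoint_extension//.
split=> [[sv tr]|[B Bb KE]].
  have full u : exists v, K (u, v).
    have [f [f' [Sf f0 _]]] := boundary_surj triplet u 0.
    have : [set x + y | x in reldom (extension_of S G0 G1 K) & y in reldom A0] f.
      by rewrite tr; exists f'.
    move=> [x [x' [/= Sx Kx]] [y [y' [/= Sy y0]] xy]].
    exists (G1 x); move: Kx; congr (K (_, _)).
    by rewrite -f0 -xy (boundaryD triplet (isG0 _ _) Sx Sy) y0 addr0.
  have [B hB] := choice full.
  have BK u v : K (u, v) <-> v = B u by split=> [h|->//]; exact: sv h (hB u).
  exists B; last by apply/seteqP; split=> [[u v] /BK|[u v] /graphE/BK].
  apply/bounded_operatorP; split.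
    by move=> a u v; apply/esym/BK; exact: KD (KZ a _ _ (hB u)) (hB v).
  apply: (@hellinger_toeplitz _ _ _ _ (cJ \o B \o cJ)) => u v.
  have := KJ (u, B u) (cJ v, B (cJ v)) (hB _) (hB _) => /=.
  have sJ := cJ_symm triplet J_symmetry SJ J_image.
  by rewrite !sJ (cJ_invol triplet J_symmetry SJ J_image).
split; first by rewrite KE => u v w /graphE -> /graphE ->.
have [_ SD SB _] := adjoint_submod S.
apply/seteqP; split=> [_ [x [x' [/= Sx _]] [y [y' [/= Sy _]] <-]]|f [f' Sf]].
  by exists (x' + y'); exact: SD.
(* [x] is chosen with boundary value in [K] and the same [G0] as [f], so that [f - x] falls into the
   domain of [A0]. *)
have [x [x' [Sx x0 x1]]] := boundary_surj triplet (G0 f) (B (G0 f)).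
exists x; first by exists x'; split=> //=; rewrite KE x0 x1.
exists (f - x); last by rewrite addrC subrK.
exists (f' - x'); split=> /=; first exact: SB.
by rewrite (boundaryB triplet (isG0 _ _) Sf Sx) x0 subrr.
Qed.

End Main.

Local Close Scope complex_scope.

Theorem theorem3p22 (R : realType) (H HH : hilbertType R)
    (S : set (H * H)) (J : H -> H)
    (D : Type) (C_ : D -> H -> H) (aJ : D)
    (G0 G1 : H -> HH) (cC_ : D -> HH -> HH)
    (S_closed : closed_operator S) (S_dense : densely_defined S)
    (S_symmetric : symmetric_operator S) (S_defect : equal_defect_numbers S)
    (J_symmetry : fundamental_symmetry J)
    (J_nontrivial : J <> id /\ J <> -%R) (SJ : commutes S J)
    (C_range : range C_ = [set C | C_symmetry_of S J C])
    (aJ_J : C_ aJ = J)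
    (triplet : boundary_triplet S G0 G1)
    (cC_def : correctly_define S G0 G1 C_ cC_)
    (A : set (H * H)) (A_closed : closed_operator A) :
  let cJ := cC_ aJ in
  let A0 := A_0 S G0 in
  (Sigma_st S J C_ A <->
     (resolvent_set A `&` resolvent_set A0) !=set0 /\
     exists2 K : set (HH * HH),
       (exists cC, admissible_parameter S G0 G1 cJ K cC) &
       krein_formula S G0 G1 A K) /\
  (forall (K : set (HH * HH)) (cC : HH -> HH),
     Sigma_st S J C_ A -> admissible_parameter S G0 G1 cJ K cC ->
     krein_formula S G0 G1 A K ->
     (disjoint_extensions S A A0 <->
        single_valued K /\ admissible_parameter S G0 G1 cJ K cC) /\
     (transversal_extensions S A A0 <->
        (exists2 B : HH -> HH, bounded_operator B & K = graph B) /\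
        admissible_parameter S G0 G1 cJ K cC)).
Proof.
move=> cJ A0.
have J_image : boundary_image S G0 G1 J cJ by have := (cC_def aJ).1; rewrite aJ_J.
have i0 : complex.Im ('i%C : R[i]) != 0 by rewrite /= oner_neq0.
have A0i : resolvent_set A0 'i%C by exact: A0_resolvent S_symmetric triplet _ i0.
have stable : Sigma_st S J C_ A -> resolvent_set A 'i%C /\
    exists2 K, A = extension_of S G0 G1 K &
      exists cC, admissible_parameter S G0 G1 cJ K cC.
  move=> [AS [a AC]].
  have C_sym : C_symmetry_of S J (C_ a).
    have : range C_ (C_ a) by exists a.
    by rewrite C_range.
  have [rA [K AK adm]] := stable_extension S_closed S_symmetric triplet J_symmetry SJ
    J_image A_closed.1 AS C_sym AC (cC_def a).1.
  by split; [exact: rA|exists K => //; exists (cC_ a)].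
(* One common point of the resolvent sets determines [A]: there the formula equates its resolvent
   with that of the extension given by [K]. *)
have krein_ext K mu cC : admissible_parameter S G0 G1 cJ K cC ->
    krein_formula S G0 G1 A K -> resolvent_set A mu -> resolvent_set A0 mu ->
    A = extension_of S G0 G1 K.
  move=> [[[Ks _] _] _ _] kr rA r0; apply: (@resolvent_inj _ _ _ _ mu).
  by rewrite (kr mu (conj rA r0)) (krein_resolvent S_symmetric triplet Ks r0).
split; first split.
- move=> /stable[rA [K AK [cC adm]]]; split; first by exists 'i%C.
  exists K; first by exists cC.
  move=> mu [_ r0]; rewrite AK; have [[[Ks _] _] _ _] := adm.
  by rewrite (krein_resolvent S_symmetric triplet Ks r0).
- move=> [[mu [rA r0]] [K [cC adm] kr]].
  have AK := krein_ext K mu cC adm kr rA r0.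
  (* Single-valuedness is read off [A], with which the extension has just been identified. *)
  have sv : single_valued (extension_of S G0 G1 K) by rewrite -AK; exact: A_closed.2.
  have [AS [C C_sym AC]] := admissible_extension S_closed S_dense S_symmetric triplet
    J_symmetry SJ J_image adm sv.
  have [a _ aC] : range C_ C by rewrite C_range.
  by rewrite AK; split=> //; exists a; rewrite aC.
move=> K cC /stable[rA _] adm kr.
have AK := krein_ext K _ cC adm kr rA A0i.
have [[[Ks _] KJ] _ _] := adm.
have KJ' f g : K f -> K g -> inner (cJ f.2) g.1 = inner (cJ f.1) g.2.
  by move=> Kf; rewrite {1}KJ; exact.
have dj := disjoint_extension S_closed S_symmetric triplet Ks.
have tr := transversal_extension S_closed S_symmetric triplet J_symmetry SJ
  J_image Ks KJ'.
rewrite AK; split; split.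
- by move=> /dj.
- by move=> [/dj].
- by move=> /tr.
- by move=> [/tr].
Qed.
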